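(* Consider an irreducible, aperiodic, positive recurrent discrete-time QBD as described in the context, with stationary distribution $\boldsymbol{\pi}=(\boldsymbol{\pi}_0,\boldsymbol{\pi}_1,\dots)$. Then its deviation matrix $\mathcal{D}=\sum_{n\ge0}(P^n-\boldsymbol{1}\boldsymbol{\pi})$ is given by $\mathcal{D}=(I-\boldsymbol{1}\boldsymbol{\pi})K$, where $K$ is the block matrix (blocks indexed by levels) with $$K_{0k}=(I-P_* )^{\#}(I-\boldsymbol{\tau}_0\boldsymbol{\pi}_0)R^k,\quad k\ge0,$$ $$K_{n0}=-\boldsymbol{\tau}_n\boldsymbol{\pi}_0+G^nK_{00},\quad n\ge1,$$ $$K_{nk}=W_{nk}-\boldsymbol{\tau}_n\boldsymbol{\pi}_k+G^nK_{0k},\quad n,k\ge1,$$ with $P_*=B+A_1G$, $\boldsymbol{\tau}_0=(I-R)^{-1}\boldsymbol{1}$ and $\boldsymbol{\tau}_n=\big((I-G^n)(I-G)^{\#}+n\boldsymbol{1}\boldsymbol{\gamma}\big)(I-U)^{-1}(I-R)^{-1}\boldsymbol{1}$ for $n\ge1$, $\boldsymbol{\gamma}$ being the invariant probability vector of $G$.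
   Context: A QBD is a Markov chain $\{X_t\}$ on $\mathbb{E}=\bigcup_{n\ge0}\ell(n)$, $\ell(n)=\{(n,j):1\le j\le m\}$, $m<\infty$, with transition matrix $P$ in block form (blocks indexed by levels) whose nonzero blocks are $P_{00}=B$, $P_{01}=A_1$, and for $n\ge1$: $P_{n,n-1}=A_{-1}$, $P_{nn}=A_0$, $P_{n,n+1}=A_1$, with $A_{-1},A_0,A_1,B$ nonnegative $m\times m$ matrices; the chain and $A_{-1}+A_0+A_1$ are assumed irreducible. With $T(\ell(n))=\inf\{t\ge1:X_t\in\ell(n)\}$, the $m\times m$ matrices $R,G,U$ (independent of $n$) are: $R_{ij}={\rm E}[\sum_{0\le t<T(\ell(n))}\mathbb{1}[X_t=(n+1,j)]\mid X_0=(n,i)]$; $G_{ij}=\mathrm{P}[T(\ell(n))<\infty, X_{T(\ell(n))}=(n,j)\mid X_0=(n+1,i)]$ ($n\ge0$); $U_{ij}=\mathrm{P}[T(\ell(n))<T(\ell(n-1)),X_{T(\ell(n))}=(n,j)\mid X_0=(n,i)]$ ($n\ge1$). The vectors $\boldsymbol{\tau}_n$ in the claim equal the expected first return times to level $0$: $(\boldsymbol{\tau}_n)_i={\rm E}[T(\ell(0))\mid X_0=(n,i)]$. $W=\sum_{\nu\ge0}H^\nu$ with blocks $W_{nk}$ ($n,k\ge1$), where $H$ is the block matrix indexed by levels $n,k\ge1$ with $H_{nn}=A_0$, $H_{n,n+1}=A_1$, $H_{n+1,n}=A_{-1}$ and other blocks zero. For a square matrix $M$, $M^{\#}$ is its group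 inverse: the unique $X$ with $MXM=M$, $XMX=X$, $MX=XM$. $\boldsymbol{1}$ is the all-ones column vector (of the appropriate size). *)

(* Defs.v *)
From HB Require Import structures.
From mathcomp Require Import all_boot all_order all_algebra.
From mathcomp Require Import boolp classical_sets reals topology normedtype sequences.
Set Implicit Arguments. Unset Strict Implicit. Unset Printing Implicit Defensive.
Import Order.TTheory GRing.Theory Num.Theory numFieldNormedType.Exports.
Local Open Scope classical_set_scope.
Local Open Scope ring_scope.

Definition sums (R : realType) (u : nat -> R) (s : R) : Prop :=
  (fun N => \sum_(k < N) u k) @ \oo --> s.

Definition msums (R : realType) (p q : nat) (u : nat -> 'M[R]_(p, q))
  (S : 'M[R]_(p, q)) : Prop :=
  forall i j, sums (fun t => u t i j) (S i j).

Definition choice_or (T : Type) (d : T) (P : T -> Prop) : T :=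
  match pselect (exists x, P x) with
  | left h => projT1 (cid h)
  | right _ => d
  end.

Section QBD.
Variables (R : realType) (m : nat) (B Am1 A0 A1 : 'M[R]_m).

(* states (n, j) : level n, phase j *)
Definition state := (nat * 'I_m)%type.

Definition Pb (n l : nat) : 'M[R]_m :=
  if n == 0%N then (if l == 0%N then B else if l == 1%N then A1 else 0)
  else if l.+1 == n then Am1
  else if l == n then A0
  else if l == n.+1 then A1 else 0.

Definition Ps (x y : state) : R := Pb x.1 y.1 x.2 y.2.

(* t-step transition probabilities (P^t)_{xy}; the sum over intermediate
   states z runs over the levels < x.1 + 2, outside of which P_{xz} = 0 *)
Fixpoint Pn (t : nat) (x y : state) : R :=
  match t with
  | 0 => (x == y)%:R
  | t'.+1 => \sum_(l < x.1.+2) \sum_(j : 'I_m) Ps x (nat_of_ord l, j) * Pn t' (nat_of_ord l, j) y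
  end.

(* taboo probabilities: Ts A t x y = P[X_t = y, X_s \notin A for 1 <= s < t | X_0 = x],
   for t >= 1 (Ts A 0 x y = 0) *)
Fixpoint Ts (A : state -> bool) (t : nat) (x y : state) : R :=
  match t with
  | 0 => 0
  | t'.+1 =>
      if t' is 0 then Ps x y
      else \sum_(l < x.1.+2) \sum_(j : 'I_m)
             (if A (nat_of_ord l, j) then 0 else Ps x (nat_of_ord l, j) * Ts A t' (nat_of_ord l, j) y)
  end.

Definition lev (S : seq nat) (x : state) : bool := x.1 \in S.

Definition blk (f : state -> state -> R) (n k : nat) : 'M[R]_m :=
  \matrix_(i, j) f (n, i) (k, j).

(* the block matrix H (levels n, l >= 1) and its powers H^nu *)
Definition Hb (n l : nat) : 'M[R]_m :=
  if l == n then A0 else if l == n.+1 then A1 else if l.+1 == n then Am1 else 0.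

Fixpoint Hpow (nu n k : nat) : 'M[R]_m :=
  match nu with
  | 0 => if n == k then 1%:M else 0
  | nu'.+1 => \sum_(1 <= l < n.+2) Hb n l *m Hpow nu' l k
  end.

Definition qbd_blocks : Prop :=
  (forall i j, 0 <= B i j /\ 0 <= Am1 i j /\ 0 <= A0 i j /\ 0 <= A1 i j) /\
  (B + A1) *m const_mx 1 = const_mx 1 :> 'cV[R]_m /\
  (Am1 + A0 + A1) *m const_mx 1 = const_mx 1 :> 'cV[R]_m /\
  (forall i j, exists t, 0 < ((Am1 + A0 + A1) ^+ t) i j).

Definition irreducible_chain : Prop :=
  forall x y : state, exists t, 0 < Pn t x y.

Definition aperiodic_chain : Prop :=
  forall (x : state) (d : nat),
    (forall t, (0 < t)%N -> 0 < Pn t x x -> (d %| t)%N) -> d = 1%N.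

Definition pos_recurrent_chain : Prop :=
  forall x : state,
    sums (fun t => Ts (fun z => z == x) t.+1 x x) 1 /\
    exists mu : R, sums (fun t => t.+1%:R * Ts (fun z => z == x) t.+1 x x) mu.

Definition stationary (pi : nat -> 'rV[R]_m) : Prop :=
  (forall n j, 0 <= pi n 0 j) /\
  sums (fun n => \sum_j pi n 0 j) 1 /\
  (forall y : state, sums (fun l => \sum_j pi l 0 j * Ps (l, j) y) (pi y.1 0 y.2)).

End QBD.

Section Blocks.
Variables (R : realType) (m : nat).

Definition is_group_inverse (M X : 'M[R]_m) : Prop :=
  M *m X *m M = M /\ X *m M *m X = X /\ M *m X = X *m M.

Definition ginv (M : 'M[R]_m) : 'M[R]_m := choice_or 0 (is_group_inverse M).

Definition inv_prob (G : 'M[R]_m) : 'rV[R]_m :=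
  choice_or 0 (fun g : 'rV[R]_m =>
    g *m G = g /\ (forall j, 0 <= g 0 j) /\ \sum_j g 0 j = 1).

Definition ones : 'cV[R]_m := const_mx 1.

Definition tau0 (Rm : 'M[R]_m) : 'cV[R]_m := invmx (1%:M - Rm) *m ones.

Definition tau (Rm Gm Um : 'M[R]_m) (n : nat) : 'cV[R]_m :=
  ((1%:M - Gm ^+ n) *m ginv (1%:M - Gm) + n%:R *: (ones *m inv_prob Gm))
    *m invmx (1%:M - Um) *m invmx (1%:M - Rm) *m ones.

Definition Pstar (B A1 Gm : 'M[R]_m) : 'M[R]_m := B + A1 *m Gm.

Definition Kblk (B A1 Rm Gm Um : 'M[R]_m) (W : nat -> nat -> 'M[R]_m)
  (pi : nat -> 'rV[R]_m) (n k : nat) : 'M[R]_m :=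
  let K0 k := ginv (1%:M - Pstar B A1 Gm) *m (1%:M - tau0 Rm *m pi 0%N) *m Rm ^+ k in
  if n == 0%N then K0 k
  else if k == 0%N then - (tau Rm Gm Um n *m pi 0%N) + Gm ^+ n *m K0 0%N
  else W n k - tau Rm Gm Um n *m pi k + Gm ^+ n *m K0 k.

End Blocks.

(* Main.v *)
Require Import Defs.
From HB Require Import structures.
From mathcomp Require Import all_boot all_order all_algebra.
From mathcomp Require Import boolp classical_sets reals topology normedtype sequences.
From mathcomp Require Import zify ring lra.
Set Implicit Arguments. Unset Strict Implicit. Unset Printing Implicit Defensive.
Import Order.TTheory GRing.Theory Num.Theory numFieldNormedType.Exports.
Local Open Scope classical_set_scope.
Local Open Scope ring_scope.

(** Write [E h] for the integral of [h] with respect to [pi].  If a column [k] of [K] has at most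
    linear growth in the level and solves the Poisson equation [k - P k = delta_y - pi(y) 1], then
    [sum_(t < N) (P^t(x, y) - pi(y)) = k(x) - P^N k(x)], so it suffices that [P^N k(x)] tends to
    [E k].

    For bounded [f], [E ((P^N f)^2)] is nonincreasing in [N], hence the [n]-step conditional
    variance of [P^N f] tends to [0] at every state; with irreducibility and aperiodicity this
    makes [P^N f] asymptotically constant, with value [E f].  Linear growth is handled by
    truncation, because [pi(x) P^N |h|(x) <= E |h|] and [pi_n = pi_0 R^n] has a first moment.

    All facts about [R], [G], [U] come from [W_11]: [W] is the minimal nonnegative solution of
    [W = I + H W], so comparison with suitable supersolutions gives [W_11 = (I - U)^-1],
    [W_1k = W_11 R^(k-1)] and [pi_k >= pi_0 R^k].  That [G] is stochastic and that the fixed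
    vectors of [P_*] are constant follows since superharmonic functions of linear growth are
    constant.  *)

(** * Sequences, series and entrywise order *)

(** Each term of [K] has one task in the Poisson equation. Above level 0, [W] accounts for the
    source [delta_y], [-tau_n pi_k] produces the constant because [P tau = tau - 1] there, and
    [G^n K_0k] is harmonic, so it does not disturb these levels and is left to be fixed by the
    equation at level 0. It is solvable because [pi_0], up to scaling the invariant vector of [P_*],
    annihilates the right side: [pi_0 R^k = pi_k] and [pi_0 tau_0 = 1]. Two solutions of linear
    growth differ by a constant, and the factor [I - 1 pi] fixes that constant.

    No sample paths are available: taboo probabilities are finite sums. Minimality of [W] therefore
    stands in for first-passage decompositions, and the variance argument for coupling. Linear
    growth is the right class because [tau_n], and with it the bound on [W_nk], grows linearly in
    [n]. *)

Section RealSequences.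
Variable R : realType.
Implicit Types (u v b : nat -> R) (a c s : R).

Definition lims u a : Prop := u @ \oo --> a.

Lemma limsP u a : lims u a <->
  forall e, 0 < e -> exists N0, forall N, (N0 <= N)%N -> `|u N - a| < e.
Proof.
rewrite /lims; split.
- move/cvgrPdist_lt => h e e0; have [N0 _ hN] := h e e0.
  by exists N0 => N le; rewrite distrC; apply: hN.
- move=> h; apply/cvgrPdist_lt => e e0; have [N0 hN] := h e e0.
  by exists N0 => // N /= le; rewrite distrC; apply: hN.
Qed.

Lemma lims_ext u v a : lims u a -> u =1 v -> lims v a.
Proof. by move=> h /funext <-. Qed.

Lemma lims_uniq u a c : lims u a -> lims u c -> a = c.
Proof. by move=> h1 h2; apply: (cvg_unique _ h1 h2); exact: norm_hausdorff. Qed.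

Lemma lims_cst a : lims (fun=> a) a.
Proof. exact: cvg_cst. Qed.
Arguments lims_cst a [t].

Lemma limsD u v a c : lims u a -> lims v c -> lims (fun N => u N + v N) (a + c).
Proof. exact: cvgD. Qed.

Lemma limsN u a : lims u a -> lims (fun N => - u N) (- a).
Proof. exact: cvgN. Qed.

Lemma limsB u v a c : lims u a -> lims v c -> lims (fun N => u N - v N) (a - c).
Proof. exact: cvgB. Qed.

Lemma limsM u v a c : lims u a -> lims v c -> lims (fun N => u N * v N) (a * c).
Proof. exact: cvgM. Qed.

Lemma limsZ c u a : lims u a -> lims (fun N => c * u N) (c * a).
Proof. by apply: limsM; exact: lims_cst. Qed.
Arguments limsZ c [u a] _ [t].

Lemma lims_sum (I : Type) (r : seq I) (u : I -> nat -> R) (a : I -> R) :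
  (forall i, lims (u i) (a i)) ->
  lims (fun N => \sum_(i <- r) u i N) (\sum_(i <- r) a i).
Proof.
move=> h; elim: r => [|i r IH].
  by rewrite big_nil; apply: lims_ext (lims_cst 0) _ => N; rewrite big_nil.
rewrite big_cons; apply: lims_ext (limsD (h i) IH) _ => N.
by rewrite big_cons.
Qed.
Arguments lims_sum [I] r [u a] _ [t].

Lemma lims_le u v a c : lims u a -> lims v c -> (forall N, u N <= v N) -> a <= c.
Proof. by move=> hu hv h; apply: (ler_cvg_to hu hv); apply: nearW. Qed.

Lemma lims_shift p u a : lims (fun N => u (N + p)%N) a <-> lims u a.
Proof. by rewrite /lims (cvg_shiftn p u (nbhs a)). Qed.

Lemma lims_eventually N0 u a : (forall N, (N0 <= N)%N -> u N = a) -> lims u a.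
Proof.
by move=> h; apply/(lims_shift N0); apply: lims_ext (lims_cst a) _ => N; rewrite h ?leq_addl.
Qed.

Lemma lims0_norm u v : (forall N, `|u N| <= v N) -> lims v 0 -> lims u 0.
Proof.
move=> h /limsP hv; apply/limsP => e e0; have [N0 hN] := hv e e0.
exists N0 => N le; have := hN N le; rewrite !subr0; apply: le_lt_trans.
by apply: le_trans (h N) (ler_norm _).
Qed.

Lemma lims0_sqr u : lims (fun N => u N ^+ 2) 0 -> lims u 0.
Proof.
move=> /limsP h; apply/limsP => e e0; have [N0 hN] := h (e ^+ 2) (exprn_gt0 _ e0).
exists N0 => N le; have := hN N le; rewrite !subr0 normrX.
by rewrite ltr_pXn2r // nnegrE ?normr_ge0 // ltW.
Qed.

Lemma lims_nondecreasing u c : (forall N, u N <= u N.+1) -> (forall N, u N <= c) ->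
  exists a, lims u a.
Proof.
move=> hS hb; exists (limn u); apply: nondecreasing_is_cvgn.
- exact/nondecreasing_seqP.
- by exists c => _ [N _ <-]; apply: hb.
Qed.

Lemma lims_nonincreasing u c : (forall N, u N.+1 <= u N) -> (forall N, c <= u N) ->
  exists a, lims u a.
Proof.
move=> hS hb.
have [|N|a ha] := @lims_nondecreasing (fun N => - u N) (- c).
- by move=> N; rewrite lerN2.
- by rewrite lerN2.
by exists (- a); apply: lims_ext (limsN ha) _ => N; rewrite opprK.
Qed.

Lemma sums_ext u v s : sums u s -> u =1 v -> sums v s.
Proof. by move=> h /funext <-. Qed.

Lemma sums_uniq u s c : sums u s -> sums u c -> s = c.
Proof. exact: lims_uniq. Qed.

Lemma sumsD u v s c : sums u s -> sums v c -> sums (fun l => u l + v l) (s + c).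
Proof. by move=> hu hv; apply: lims_ext (limsD hu hv) _ => N; rewrite big_split. Qed.

Lemma sumsZ c u s : sums u s -> sums (fun l => c * u l) (c * s).
Proof. by move=> hu; apply: lims_ext (limsZ c hu) _ => N; rewrite mulr_sumr. Qed.
Arguments sumsZ c [u s] _ [t].

Lemma sums_le u v s c : sums u s -> sums v c -> (forall l, u l <= v l) -> s <= c.
Proof. by move=> hu hv h; apply: lims_le hu hv _ => N; apply: ler_sum. Qed.

Lemma sums_bounded u c : (forall l, 0 <= u l) -> (forall N, \sum_(l < N) u l <= c) ->
  exists s, sums u s.
Proof.
by move=> h0 hc; apply: (@lims_nondecreasing _ c) => // N; rewrite big_ord_recr /= lerDl.
Qed.

Lemma sums_ge_partial u s N : (forall l, 0 <= u l) -> sums u s -> \sum_(l < N) u l <= s.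
Proof.
move=> h0 hs; apply: (lims_le (lims_cst _) ((lims_shift N _ _).2 hs)) => p.
elim: p => [|p IH]; first by rewrite add0n.
by rewrite addSn big_ord_recr /=; apply: le_trans IH _; rewrite lerDl.
Qed.

Lemma sums_term0 u s : sums u s -> lims u 0.
Proof.
move=> hs; have h1 := (lims_shift 1 _ _).2 hs.
rewrite -(subrr s); apply: lims_ext (limsB h1 hs) _ => N.
by rewrite addn1 big_ord_recr /=; set x := \sum_(_ < _) _; ring.
Qed.

(** [u] is the difference of the nonnegative sequences [u + b] and [b], both with bounded partial
    sums. *)
Lemma sums_dominated u b s : (forall l, `|u l| <= b l) -> sums b s -> exists c, sums u c.
Proof.
move=> ub hb.
have b0 l : 0 <= b l by apply: le_trans (normr_ge0 _) (ub l).
have hbu l := ler_normlP _ _ (ub l).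
have [|N|c1 h1] := @sums_bounded (fun l => u l + b l) (s + s).
- by move=> l; have [] := hbu l; lra.
- rewrite big_split /=; apply: lerD; last exact: sums_ge_partial.
  apply: le_trans (sums_ge_partial N b0 hb); apply: ler_sum => i _.
  by have [] := hbu i; lra.
exists (c1 + (-1) * s); apply: sums_ext (sumsD h1 (sumsZ (-1) hb)) _ => l; lra.
Qed.

Lemma sums_le_norm u b s c : (forall l, `|u l| <= b l) -> sums b s -> sums u c -> `|c| <= s.
Proof.
move=> ub hb hu; apply/ler_normlP; split.
- rewrite -mulN1r; apply: (sums_le (sumsZ (-1) hu) hb) => l.
  by have /ler_normlP [] := ub l; lra.
- by apply: (sums_le hu hb) => l; apply: le_trans (ler_norm _) (ub l).
Qed.

(** Dominated convergence for series: beyond a fixed [L] the tail of [b] bounds every [w N]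
    uniformly, and the finitely many terms before [L] vanish in the limit. *)
Lemma tannery (w : nat -> nat -> R) b s (c : nat -> R) :
  (forall N l, `|w N l| <= b l) -> sums b s ->
  (forall l, lims (w^~ l) 0) -> (forall N, sums (w N) (c N)) -> lims c 0.
Proof.
move=> wb hb w0 hc; apply/limsP => e e0.
have b0 l : 0 <= b l by apply: le_trans (normr_ge0 _) (wb 0%N l).
have e20 : 0 < e / 2 by lra.
have [L hL] := (limsP _ _).1 hb _ e20.
have hf : lims (fun N => \sum_(l <- iota 0 L) `|w N l|) 0.
  have hz : (0 : R) = \sum_(l <- iota 0 L) 0 by rewrite big1.
  rewrite [X in lims _ X]hz.
  apply: lims_sum => l; have := cvg_norm (w0 l); rewrite normr0; exact.
have [N0 hN] := (limsP _ _).1 hf _ e20.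
exists N0 => N le; rewrite subr0.
have hle : `|c N| <= \sum_(l <- iota 0 L) `|w N l| + e / 2.
  have nl : lims (fun M => `|\sum_(l < M + L) w N l|) `|c N|.
    by apply: cvg_norm; apply: (lims_shift L _ _).2 (hc N).
  apply: (lims_le nl (lims_cst _)) => M.
  have tail : \sum_(l < M + L) `|w N l| <= \sum_(l <- iota 0 L) `|w N l|
      + (\sum_(l < M + L) b l - \sum_(l < L) b l).
    elim: M => [|M IH].
      rewrite add0n subrr addr0 -(big_mkord xpredT (fun l => `|w N l|)).
      by rewrite /index_iota subn0.
    rewrite addSn !big_ord_recr /=; have := wb N (M + L)%N.
    move: IH; set x := \sum_(_ < _) _; set y := \sum_(_ < _) _; lra.
  apply: le_trans (ler_norm_sum _ _ _) (le_trans tail _).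
  have hs : \sum_(l < M + L) b l <= s by apply: sums_ge_partial.
  have := hL L (leqnn _); move=> /ltr_normlP []; lra.
have := hN N le; rewrite subr0 => /ltr_normlP []; lra.
Qed.

End RealSequences.
Arguments lims_cst {R} a [t].
Arguments limsZ {R} c [u a] _ [t].
Arguments sumsZ {R} c [u s] _ [t].
Arguments lims_sum {R} [I] r [u a] _ [t].

(** * Entrywise order and limits of matrices, Neumann series *)

Section MatrixOrder.
Variable R : realType.

Definition mle p q (A B : 'M[R]_(p, q)) : Prop := forall i j, A i j <= B i j.
Local Notation "A <=m B" := (mle A B) (at level 70).

Lemma mle_refl p q (A : 'M[R]_(p, q)) : A <=m A.
Proof. by []. Qed.

Lemma mle_trans p q (B A C : 'M[R]_(p, q)) : A <=m B -> B <=m C -> A <=m C.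
Proof. by move=> h1 h2 i j; apply: le_trans (h1 i j) (h2 i j). Qed.

Lemma mle_anti p q (A B : 'M[R]_(p, q)) : A <=m B -> B <=m A -> A = B.
Proof. by move=> h1 h2; apply/matrixP => i j; apply/le_anti; rewrite h1 h2. Qed.

Lemma mleD p q (A B C D : 'M[R]_(p, q)) : A <=m B -> C <=m D -> A + C <=m B + D.
Proof. by move=> h1 h2 i j; rewrite !mxE lerD. Qed.

Lemma mleM2l p q r (C : 'M[R]_(p, q)) (A B : 'M[R]_(q, r)) :
  0 <=m C -> A <=m B -> C *m A <=m C *m B.
Proof.
move=> h1 h2 i j; rewrite !mxE; apply: ler_sum => k _; apply: ler_wpM2l => //.
by have := h1 i k; rewrite mxE.
Qed.

Lemma mleM2r p q r (C : 'M[R]_(q, r)) (A B : 'M[R]_(p, q)) :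
  0 <=m C -> A <=m B -> A *m C <=m B *m C.
Proof.
move=> h1 h2 i j; rewrite !mxE; apply: ler_sum => k _; apply: ler_wpM2r => //.
by have := h1 k j; rewrite mxE.
Qed.

Lemma mulmx_ge0 p q r (A : 'M[R]_(p, q)) (B : 'M[R]_(q, r)) :
  0 <=m A -> 0 <=m B -> 0 <=m A *m B.
Proof. by move=> hA hB; rewrite -(mulmx0 _ A); apply: mleM2l. Qed.

Lemma addmx_ge0 p q (A B : 'M[R]_(p, q)) : 0 <=m A -> 0 <=m B -> 0 <=m A + B.
Proof. by move=> hA hB; rewrite -(addr0 0); apply: mleD. Qed.

Lemma summx_ge0 p q (I : Type) (r : seq I) (F : I -> 'M[R]_(p, q)) :
  (forall i, 0 <=m F i) -> 0 <=m \sum_(i <- r) F i.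
Proof.
move=> h; elim: r => [|i r IH]; first by rewrite big_nil.
by rewrite big_cons; apply: addmx_ge0.
Qed.

Lemma scalar1_ge0 n : 0 <=m (1%:M : 'M[R]_n).
Proof. by move=> i j; rewrite !mxE; case: (_ == _). Qed.

Lemma expmx_ge0 n (A : 'M[R]_n) k : 0 <=m A -> 0 <=m A ^+ k.
Proof.
move=> hA; elim: k => [|k IH]; first by rewrite expr0; apply: scalar1_ge0.
by rewrite exprS; apply: mulmx_ge0.
Qed.

Lemma ones_ge0 n : 0 <=m ones R n.
Proof. by move=> i j; rewrite !mxE ler01. Qed.

Lemma trmx_ge0 p q (A : 'M[R]_(p, q)) : 0 <=m A -> 0 <=m A^T.
Proof. by move=> h i j; have := h j i; rewrite !mxE. Qed.

Definition mlim p q (u : nat -> 'M[R]_(p, q)) (A : 'M[R]_(p, q)) : Prop :=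
  forall i j, lims (fun N => u N i j) (A i j).

Lemma mlim_ext p q (u v : nat -> 'M[R]_(p, q)) A : mlim u A -> u =1 v -> mlim v A.
Proof. by move=> h /funext <-. Qed.

Lemma mlim_uniq p q (u : nat -> 'M[R]_(p, q)) A B : mlim u A -> mlim u B -> A = B.
Proof. by move=> h1 h2; apply/matrixP => i j; apply: lims_uniq (h1 i j) (h2 i j). Qed.

Lemma mlim_cst p q (A : 'M[R]_(p, q)) : mlim (fun=> A) A.
Proof. by move=> i j; apply: lims_cst. Qed.
Arguments mlim_cst [p q] A i j.

Lemma mlimD p q (u v : nat -> 'M[R]_(p, q)) A B :
  mlim u A -> mlim v B -> mlim (fun N => u N + v N) (A + B).
Proof.
move=> h1 h2 i j; rewrite mxE; apply: lims_ext (limsD (h1 i j) (h2 i j)) _ => N.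
by rewrite mxE.
Qed.

Lemma mlimMl p q r (C : 'M[R]_(p, q)) (u : nat -> 'M[R]_(q, r)) A :
  mlim u A -> mlim (fun N => C *m u N) (C *m A).
Proof.
move=> h i j; rewrite mxE.
have hk k : lims (fun N => C i k * u N k j) (C i k * A k j) by exact: limsZ.
apply: lims_ext (lims_sum (index_enum 'I_q) hk) _ => N.
by rewrite mxE.
Qed.
Arguments mlimMl [p q r] C [u A] _ i j.

Lemma mlim_tr p q (u : nat -> 'M[R]_(p, q)) A : mlim u A -> mlim (fun N => (u N)^T) A^T.
Proof. by move=> h i j; rewrite mxE; apply: lims_ext (h j i) _ => N; rewrite mxE. Qed.

Lemma mlimMr p q r (C : 'M[R]_(q, r)) (u : nat -> 'M[R]_(p, q)) A :
  mlim u A -> mlim (fun N => u N *m C) (A *m C).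
Proof.
move=> /mlim_tr /(mlimMl C^T) /mlim_tr; rewrite -trmx_mul trmxK.
by move/mlim_ext; apply=> N; rewrite -trmx_mul trmxK.
Qed.
Arguments mlimMr [p q r] C [u A] _ i j.

Lemma mlim_sum p q (I : Type) (r : seq I) (u : I -> nat -> 'M[R]_(p, q)) A :
  (forall i, mlim (u i) (A i)) ->
  mlim (fun N => \sum_(i <- r) u i N) (\sum_(i <- r) A i).
Proof.
move=> h i j; rewrite summxE.
have hk k : lims (fun N => u k N i j) (A k i j) by exact: h.
apply: lims_ext (lims_sum r hk) _ => N.
by rewrite summxE.
Qed.
Arguments mlim_sum [p q I] r [u A] _ i j.

Lemma mlim_shift k p q (u : nat -> 'M[R]_(p, q)) A :
  mlim (fun N => u (N + k)%N) A <-> mlim u A.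
Proof. by split=> h i j; apply/(lims_shift k (fun N => u N i j)); apply: h. Qed.

Lemma mlim_le p q (u v : nat -> 'M[R]_(p, q)) A B :
  mlim u A -> mlim v B -> (forall N, u N <=m v N) -> A <=m B.
Proof. by move=> h1 h2 h i j; apply: lims_le (h1 i j) (h2 i j) _ => N; apply: h. Qed.

Lemma msumsP p q (u : nat -> 'M[R]_(p, q)) A :
  msums u A <-> mlim (fun N => \sum_(k < N) u k) A.
Proof.
split=> h i j.
- by apply: lims_ext (h i j) _ => N; rewrite summxE.
- by apply: lims_ext (h i j) _ => N; rewrite summxE.
Qed.

(** Bounded partial sums of a nonnegative series converge, hence [M ^+ k] tends to 0 and the
    telescoping identity [(1 - M) (1 + ... + M ^+ (K-1)) = 1 - M ^+ K] passes to the limit. *)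
Lemma neumann n (M C : 'M[R]_n) : 0 <=m M ->
  (forall K, \sum_(k < K) M ^+ k <=m C) ->
  [/\ 1%:M - M \in unitmx, msums (fun k => M ^+ k) (invmx (1%:M - M)),
      0 <=m invmx (1%:M - M) & invmx (1%:M - M) <=m C].
Proof.
move=> M0 hC.
have Mk0 i j k : 0 <= (M ^+ k) i j by have := expmx_ge0 k M0 i j; rewrite mxE.
have hex i j : exists s, sums (fun k => (M ^+ k) i j) s.
  apply: (@sums_bounded _ _ (C i j)) => // K.
  by have := hC K i j; rewrite summxE.
pose S := \matrix_(i, j) projT1 (cid (hex i j)).
have hS : msums (fun k => M ^+ k) S.
  by move=> i j; rewrite mxE; case: cid.
have hinv : (1%:M - M) *m S = 1%:M.
  have hS' := (msumsP _ _).1 hS.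
  have hM : mlim (fun k => M ^+ k) 0.
    by move=> i j; rewrite mxE; apply: sums_term0 (hS i j).
  have h1 := mlimMl (1%:M - M) hS'.
  apply: mlim_uniq h1 _.
  have := mlimD (mlim_cst 1%:M) (mlimMl (-1)%:M hM); rewrite mulmx0 addr0.
  move/mlim_ext; apply=> N; rewrite mul_scalar_mx scaleN1r.
  elim: N => [|N IH]; first by rewrite big_ord0 mulmx0 expr0 subrr.
  rewrite big_ord_recr /= mulmxDr -IH mulmxBl mul1mx exprS -mulmxE.
  by rewrite -addrA [- M ^+ N + _]addrA addNr add0r.
have [hu _] := mulmx1_unit hinv.
have -> : invmx (1%:M - M) = S.
  by rewrite -(mulKmx hu S) hinv mulmx1.
split=> // i j.
- rewrite mxE; apply: lims_le (lims_cst 0) (hS i j) _ => K.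
  by apply: sumr_ge0.
- by apply: lims_le (hS i j) (lims_cst (C i j)) _ => K; have := hC K i j; rewrite summxE.
Qed.

End MatrixOrder.
Arguments mlim_cst {R} [p q] A i j.
Arguments mlimMl {R} [p q r] C [u A] _ i j.
Arguments mlimMr {R} [p q r] C [u A] _ i j.
Arguments mlim_sum {R} [p q I] r [u A] _ i j.

Local Notation "A <=m B" := (mle A B) (at level 70).
#[local] Hint Resolve mle_refl : core.

(** * The potential of the chain killed at level 0 *)

Section TabooPotential.
Variables (R : realType) (m : nat) (Am1 A0 A1 : 'M[R]_m).
Local Notation Hb := (Hb Am1 A0 A1).
Local Notation Hpow := (Hpow Am1 A0 A1).

(** [H] has no level 0, so at [n = 1] the downward term is missing. Adding it back gives a
    three-term expression that is uniform in [n]. *)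
Lemma sum_Hb p (X : nat -> 'M[R]_(m, p)) n : (0 < n)%N ->
  \sum_(1 <= l < n.+2) Hb n l *m X l + (if n == 1%N then Am1 *m X 0%N else 0)
  = Am1 *m X n.-1 + A0 *m X n + A1 *m X n.+1.
Proof.
case: n => // n _; rewrite big_nat_recr //= big_nat_recr //=.
have -> : Hb n.+1 n.+1 = A0 by rewrite /Defs.Hb eqxx.
have -> : Hb n.+1 n.+2 = A1 by rewrite /Defs.Hb eqn_leq ltnn /= eqxx.
case: n => [|n].
  by rewrite big_geq //= add0r [LHS]addrC addrA.
rewrite big_nat_recr //= addr0.
have -> : Hb n.+2 n.+1 = Am1.
  by rewrite /Defs.Hb; do 2![case: eqP => [?|_]; first lia]; rewrite eqxx.
rewrite big_nat_cond big1 ?add0r // => l /andP[/andP[h1 h2] _].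
by rewrite /Defs.Hb !ltn_eqF ?mul0mx //=; lia.
Qed.

Lemma Hpow_sumS nu n k : \sum_(s < nu.+1) Hpow s n k
  = (if n == k then 1%:M else 0)
    + \sum_(1 <= l < n.+2) Hb n l *m (\sum_(s < nu) Hpow s l k).
Proof.
rewrite big_ord_recl /=; congr (_ + _).
under [RHS]eq_bigr do rewrite mulmx_sumr.
by rewrite exchange_big.
Qed.

Hypotheses (Am1_ge0 : 0 <=m Am1) (A0_ge0 : 0 <=m A0) (A1_ge0 : 0 <=m A1).

Lemma Hb_ge0 n l : 0 <=m Hb n l.
Proof. by rewrite /Defs.Hb; case: ifP => // _; case: ifP => // _; case: ifP. Qed.

Lemma Hpow_ge0 nu n k : 0 <=m Hpow nu n k.
Proof.
elim: nu n => [|nu IH] n /=; first by case: ifP => // _; apply: scalar1_ge0.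
by apply: summx_ge0 => l; apply: mulmx_ge0; [apply: Hb_ge0|apply: IH].
Qed.

(** Partial sums of the potential stay below every nonnegative supersolution. The right factor [C]
    lets the comparison be made with vectors as well as with square blocks. *)
Lemma Hpow_sum_minimal p (C : 'M[R]_(m, p)) (Z : nat -> 'M[R]_(m, p)) k :
  (forall n, (0 < n)%N -> 0 <=m Z n) ->
  (forall n, (0 < n)%N ->
    (if n == k then C else 0) + \sum_(1 <= l < n.+2) Hb n l *m Z l <=m Z n) ->
  forall nu n, (0 < n)%N -> (\sum_(s < nu) Hpow s n k) *m C <=m Z n.
Proof.
move=> Z0 hZ; elim=> [|nu IH] n n0; first by rewrite big_ord0 mul0mx; apply: Z0.
apply: mle_trans (hZ n n0); rewrite Hpow_sumS mulmxDl; apply: mleD.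
  by case: ifP => _; rewrite ?mul1mx ?mul0mx.
rewrite mulmx_suml !big_seq; elim/big_rec2: _ => // l x y.
rewrite mem_index_iota => /andP[l0 _] h; apply: mleD => //.
by rewrite -mulmxA; apply: mleM2l; [apply: Hb_ge0|apply: IH].
Qed.

Variable W : nat -> nat -> 'M[R]_m.

Section OneColumn.
Variable k : nat.
Hypothesis W_sums : forall n, (0 < n)%N -> msums (fun nu => Hpow nu n k) (W n k).

Lemma W_minimal p (C : 'M[R]_(m, p)) (Z : nat -> 'M[R]_(m, p)) :
  (forall n, (0 < n)%N -> 0 <=m Z n) ->
  (forall n, (0 < n)%N ->
    (if n == k then C else 0) + \sum_(1 <= l < n.+2) Hb n l *m Z l <=m Z n) ->
  forall n, (0 < n)%N -> W n k *m C <=m Z n.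
Proof.
move=> Z0 hZ n n0.
have h := mlimMr C ((msumsP _ _).1 (W_sums n0)).
by apply: mlim_le h (mlim_cst _) _ => nu; apply: Hpow_sum_minimal.
Qed.

Lemma W_ge0 n : (0 < n)%N -> 0 <=m W n k.
Proof.
move=> n0; apply: mlim_le (mlim_cst 0) ((msumsP _ _).1 (W_sums n0)) _ => nu.
by apply: summx_ge0 => s; apply: Hpow_ge0.
Qed.

Lemma W_eq n : (0 < n)%N ->
  W n k = (if n == k then 1%:M else 0) + \sum_(1 <= l < n.+2) Hb n l *m W l k.
Proof.
move=> n0; have h := (msumsP _ _).1 (W_sums n0).
have /(_ _ _) h1 := (mlim_shift 1 _ _).2 h.
apply: mlim_uniq h1 _.
(* Convergence is assumed at positive levels only, whereas [mlim_sum] asks for it at every index;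
   the guard supplies the zero default at level 0. *)
have hl l : mlim (fun nu => if (0 < l)%N then Hb n l *m \sum_(s < nu) Hpow s l k else 0)
   (if (0 < l)%N then Hb n l *m W l k else 0).
  case: ifP => l0; last exact: mlim_cst.
  exact: (mlimMl _ ((msumsP _ _).1 (W_sums l0))).
have := mlimD (mlim_cst (if n == k then 1%:M else 0)) (mlim_sum (index_iota 1 n.+2) hl).
have -> : \sum_(i <- index_iota 1 n.+2) (if (0 < i)%N then Hb n i *m W i k else 0)
   = \sum_(1 <= l < n.+2) Hb n l *m W l k.
  by apply: eq_big_nat => i /andP[-> _].
move/mlim_ext; apply=> N; rewrite addn1 Hpow_sumS; congr (_ + _).
by apply: eq_big_nat => i /andP[-> _].
Qed.

(** The value [W 0 k] is arbitrary; for [n = 1] it occurs on both sides and cancels. *)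
Lemma W_rec n : (0 < n)%N ->
  W n k + (if n == 1%N then Am1 *m W 0%N k else 0)
  = (if n == k then 1%:M else 0) + (Am1 *m W n.-1 k + A0 *m W n k + A1 *m W n.+1 k).
Proof. by move=> n0; rewrite {1}W_eq // -addrA (sum_Hb (fun l => W l k)). Qed.

End OneColumn.

Hypothesis W_sums : forall n, (0 < n)%N -> msums (fun nu => Hpow nu n 1) (W n 1%N).

(** At this stage these are algebraic expressions in [W_11]; their probabilistic meaning is
    established by [Gm_eq] and [Um_eq]. *)
Let N := W 1 1.
Let G := N *m Am1.
Let U := A0 + A1 *m G.

Let N_ge0 : 0 <=m N.
Proof. exact: (W_ge0 W_sums). Qed.

(** To visit level 1 from level [n+1] the chain must first come down to level 2 and step from there
    to level 1. Analytically, the shifted column solves the equation with source [Am1 N] at [n = 1],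
    which is exactly the downward term that the sum over positive levels omits. *)
Lemma W_shift_ge n : (0 < n)%N -> W n 1 *m (Am1 *m N) <=m W n.+1 1.
Proof.
move=> n0; apply: (W_minimal W_sums (Z := fun n => W n.+1 1%N)) => // {n n0} n n0.
  exact: (W_ge0 W_sums).
have := sum_Hb (fun l => W l.+1 1%N) n0; rewrite addrC => ->.
have := W_rec W_sums (ltn0Sn n); rewrite !eqSS (gtn_eqF n0) addr0 add0r.
by rewrite prednK //= => <-.
Qed.

(* [W_shift_ge] gives [1 + U N <= N], so the Neumann series [V] of [U] converges with [V <= N];
   the powers of [V Am1] applied to [V] form a supersolution, whence [N <= V] by minimality. *)
Lemma W_first_column :
  [/\ 1%:M - U \in unitmx, invmx (1%:M - U) = N
    & forall n, W n.+1 1 = G ^+ n *m N].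
Proof.
have G0 : 0 <=m G by apply: mulmx_ge0.
have U0 : 0 <=m U by apply: addmx_ge0 => //; apply: mulmx_ge0.
have hN : 1%:M + U *m N <=m N.
  have hN1 : N = 1%:M + (A0 *m N + A1 *m W 2 1).
    apply: (addrI (Am1 *m W 0%N 1%N)).
    have := W_rec W_sums (ltn0Sn 0); rewrite eqxx [LHS]addrC => ->.
    by rewrite [RHS]addrCA !addrA.
  rewrite [X in _ <=m X]hN1; apply: mleD => //.
  rewrite mulmxDl; apply: mleD => //; rewrite -mulmxA; apply: mleM2l => //.
  by have := W_shift_ge (ltn0Sn 0); rewrite mulmxA.
have hsum K : \sum_(k < K) U ^+ k <=m N.
  elim: K => [|K IH]; first by rewrite big_ord0.
  rewrite big_ord_recl expr0; apply: mle_trans hN; apply: mleD => //.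
  rewrite (eq_bigr (fun k : 'I_K => U *m U ^+ k)) => [|k _].
    by rewrite -mulmx_sumr; apply: mleM2l.
  by rewrite lift0 exprS.
have [uU _ V0 VN] := neumann U0 hsum.
set V := invmx (1%:M - U) in V0 VN *.
have hV : V = 1%:M + U *m V.
  have : (1%:M - U) *m V = 1%:M by rewrite mulmxV.
  by rewrite mulmxBl mul1mx => /eqP; rewrite subr_eq => /eqP.
have [G' defG'] : exists G', G' = V *m Am1 by exists (V *m Am1).
have G'0 : 0 <=m G' by rewrite defG'; apply: mulmx_ge0.
have G'G : G' <=m G by rewrite defG'; apply: mleM2r.
have hG' : G' = Am1 + U *m G' by rewrite defG' {1}hV mulmxDl mul1mx mulmxA.
have Z0 n : 0 <=m G' ^+ n *m V by apply: mulmx_ge0 => //; apply: expmx_ge0.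
have WV n : W n.+1 1 <=m G' ^+ n *m V.
  rewrite -[W n.+1 1%N]mulmx1.
  apply: (W_minimal W_sums (Z := fun n => G' ^+ n.-1 *m V)) => // {n} n n0.
  have := sum_Hb (fun n => if n == 0%N then 0 else G' ^+ n.-1 *m V) n0.
  rewrite mulmx0 if_same addr0 (gtn_eqF n0) /= => hs.
  have -> : \sum_(1 <= l < n.+2) Hb n l *m (G' ^+ l.-1 *m V) =
    \sum_(1 <= l < n.+2) Hb n l *m (if l == 0%N then 0 else G' ^+ l.-1 *m V).
    by apply: eq_big_nat => l /andP[l0 _]; rewrite gtn_eqF.
  rewrite {}hs; case: n n0 => // n _ /=; rewrite eqSS.
  (* [U] contains [G] and not [G'], so the powers of [G'] satisfy the recursion only as an
     inequality, obtained by enlarging [A1 G'] to [A1 G]. *)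
  have hAG : A1 *m G' <=m A1 *m G by apply: mleM2l.
  case: n => [|n].
    rewrite !eqxx mulmx0 add0r expr0 expr1 mul1mx [X in _ <=m X]hV.
    apply: mleD => //; rewrite mulmxDl; apply: mleD => //.
    by rewrite mulmxA; apply: mleM2r.
  rewrite /= add0r [G' ^+ n.+2]exprS exprS -!mulmxE -!mulmxA.
  set Y := G' ^+ n *m V; have Y0 : 0 <=m Y by apply: Z0.
  clearbody Y.
  have hGY : G' *m Y = (Am1 + U *m G') *m Y by rewrite -hG'.
  rewrite [X in _ <=m X]hGY.
  rewrite !mulmxA -!mulmxDl; apply: mleM2r => //.
  rewrite -addrA; apply: mleD => //.
  by rewrite /U mulmxDl; apply: mleD => //; apply: mleM2r.
have NV : N = V by apply: mle_anti => //; have := WV 0%N; rewrite expr0 mul1mx.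
have GG' : G' = G by rewrite defG' /G NV.
split=> // n; elim: n => [|n IH]; first by rewrite expr0 mul1mx.
apply: mle_anti; first by have := WV n.+1; rewrite GG' -NV.
have := W_shift_ge (ltn0Sn n); rewrite IH; apply: mle_trans.
by rewrite exprSr -mulmxE /G !mulmxA.
Qed.

End TabooPotential.

(** * Transposition, and the first block row of W *)

Section Transpose.
Variables (R : realType) (m : nat) (Am1 A0 A1 : 'M[R]_m).
Local Notation Hb := (Hb Am1 A0 A1).
Local Notation Hpow := (Hpow Am1 A0 A1).

Lemma Hb_out n l : (n.+1 < l)%N || (l.+1 < n)%N -> Hb n l = 0.
Proof. by rewrite /Defs.Hb => h; do ![case: eqP => ?; first lia]. Qed.

Lemma sum_Hb_widen p (X : nat -> 'M[R]_(m, p)) n K : (n.+2 <= K)%N ->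
  \sum_(1 <= l < n.+2) Hb n l *m X l = \sum_(1 <= l < K) Hb n l *m X l.
Proof.
move=> h; rewrite [RHS](big_cat_nat (n := n.+2)) //= [X in _ + X]big_nat_cond.
rewrite [X in _ + X]big1 ?addr0 // => l /andP[/andP[h1 _] _].
by rewrite Hb_out ?mul0mx // h1.
Qed.

(** The powers of [H] are defined by multiplication on the left; transposition needs the recursion
    on the right. The free bound [K] makes the range of the inner sum independent of the outer
    index. *)
Lemma Hpow_recr nu n k K : (0 < n)%N -> (0 < k)%N -> (k.+2 <= K)%N ->
  Hpow nu.+1 n k = \sum_(1 <= l < K) Hpow nu n l *m Hb l k.
Proof.
move=> n0 k0; elim: nu n n0 K => [|nu IH] n n0 K hK.
  have hl l : (0 < l)%N -> Hb n l *m Hpow 0 l k = if l == k then Hb n l else 0.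
    by move=> _ /=; case: eqP => _; rewrite ?mulmx1 ?mulmx0.
  have hr l : Hpow 0 n l *m Hb l k = if l == n then Hb n k else 0.
    by move=> /=; rewrite eq_sym; case: eqP => [->|_]; rewrite ?mul1mx ?mul0mx.
  rewrite [LHS](_ : _ = Hb n k); last first.
    rewrite [LHS]/= (@sum_Hb_widen _ (fun l => Hpow 0 l k) n (n + k).+2) ?ltnS ?leq_addr //.
    rewrite (eq_big_nat _ _ (F2 := fun l => if l == k then Hb n l else 0)).
      by rewrite -big_mkcond big_nat1_eq k0 /= ltnS leqW ?leq_addl.
    by move=> l /andP[l0 _]; rewrite hl.
  under eq_bigr do rewrite hr.
  rewrite -big_mkcond big_nat1_eq n0 /=; case: ltnP => // Kn.
  by rewrite Hb_out // (leq_trans _ Kn) ?orbT.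
have -> : Hpow nu.+2 n k = \sum_(1 <= l < n.+2) Hb n l *m Hpow nu.+1 l k by [].
rewrite (eq_big_nat _ _ (F2 := fun l => \sum_(1 <= q < K) Hb n l *m (Hpow nu l q *m Hb q k))).
  rewrite exchange_big /=; apply: eq_bigr => q _.
  by rewrite mulmx_suml; apply: eq_bigr => l _; rewrite mulmxA.
by move=> l /andP[l0 _]; rewrite -mulmx_sumr (IH _ l0 K).
Qed.

(** The transpose of [H] is again of QBD form, with the roles of [Am1] and [A1] exchanged.
    Statements about the first block column therefore turn into statements about the first block
    row. *)
Lemma Hpow_tr nu n k : (0 < n)%N -> (0 < k)%N ->
  Defs.Hpow A1^T A0^T Am1^T nu k n = (Hpow nu n k)^T.
Proof.
move=> n0; elim: nu k => [|nu IH] k k0.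
  by rewrite /= eq_sym; case: eqP; rewrite ?trmx1 ?trmx0.
rewrite (@Hpow_recr nu n k k.+2) // linear_sum /=.
apply: eq_big_nat => l /andP[l0 _]; rewrite trmx_mul IH //; congr (_ *m _).
rewrite /Defs.Hb [l == k]eq_sym; case: eqP => // /eqP hlk.
by do ![case: eqP => ?]; rewrite ?trmx0 //; exfalso; lia.
Qed.

End Transpose.

Section FirstRow.
Variables (R : realType) (m : nat) (Am1 A0 A1 : 'M[R]_m).
Hypotheses (Am1_ge0 : 0 <=m Am1) (A0_ge0 : 0 <=m A0) (A1_ge0 : 0 <=m A1).
Variable W : nat -> nat -> 'M[R]_m.
Hypothesis W_sums : forall n k, (0 < n)%N -> (0 < k)%N ->
  msums (fun nu => Hpow Am1 A0 A1 nu n k) (W n k).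

Let WT n k := (W k n)^T.

Let WT_sums n : (0 < n)%N -> msums (fun nu => Hpow A1^T A0^T Am1^T nu n 1) (WT n 1).
Proof.
move=> n0; apply/msumsP.
apply: mlim_ext (mlim_tr ((msumsP _ _).1 (W_sums (ltn0Sn 0) n0))) _ => K.
by rewrite linear_sum /=; apply: eq_bigr => s _; rewrite Hpow_tr.
Qed.

Lemma W_first_row k : W 1 k.+1 = W 1 1 *m (A1 *m W 1 1) ^+ k.
Proof.
have [_ _ /(_ k)] := W_first_column (trmx_ge0 A1_ge0) (trmx_ge0 A0_ge0)
  (trmx_ge0 Am1_ge0) WT_sums.
rewrite /WT -trmx_mul; move: (A1 *m _) => M h; apply: trmx_inj; rewrite h [RHS]trmx_mul.
congr (_ *m _); elim: k {h} => [|k IH]; first by rewrite !expr0 trmx1.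
by rewrite exprS exprSr IH -mulmxE trmx_mul.
Qed.

(** Above level 0, [rho] solves the row equation for [H] with source [rho 0 *m A1], the mass that
    enters level 1 from below. The potential gives the least such solution. *)
Lemma W_row_minimal (rho : nat -> 'rV[R]_m) :
  (forall n, 0 <=m rho n) ->
  (forall n, rho n.+1 = rho n *m A1 + rho n.+1 *m A0 + rho n.+2 *m Am1) ->
  forall n, rho 0%N *m A1 *m W 1 n.+1 <=m rho n.+1.
Proof.
move=> rho0 hrho n i j.
have : WT n.+1 1 *m (A1^T *m (rho 0%N)^T) <=m (rho n.+1)^T.
  apply: (W_minimal (trmx_ge0 A1_ge0) (trmx_ge0 A0_ge0) (trmx_ge0 Am1_ge0) WT_sums
    (Z := fun n => (rho n)^T)) => // n' n0; first exact: trmx_ge0.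
  rewrite addrC (sum_Hb _ _ _ (fun n => (rho n)^T)) //.
  case: n' n0 => // n' _ /=; rewrite -!trmx_mul -!linearD /=.
  by rewrite -hrho.
by move/(_ j i); rewrite /WT -!trmx_mul !mxE.
Qed.

End FirstRow.

(** * Taboo probabilities as powers of H; R, G and U in terms of W_11 *)

Section TabooProbabilities.
Variables (R : realType) (m : nat) (B Am1 A0 A1 : 'M[R]_m).
Local Notation Pb := (Pb B Am1 A0 A1).
Local Notation Ts S := (Ts B Am1 A0 A1 (lev S)).

Lemma blk_Ts1 S n k : blk (Ts S 1) n k = Pb n k.
Proof. by apply/matrixP => i j; rewrite mxE. Qed.

Lemma blk_TsS S t n k : blk (Ts S t.+2) n k =
  \sum_(0 <= l < n.+2 | l \notin S) Pb n l *m blk (Ts S t.+1) l k.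
Proof.
apply/matrixP => i j; rewrite mxE big_mkcond big_mkord summxE.
have -> : Ts S t.+2 (n, i) (k, j) = \sum_(l < n.+2) \sum_j0
   (if lev S (nat_of_ord l, j0) then 0 else
     Ps B Am1 A0 A1 (n, i) (nat_of_ord l, j0) * Ts S t.+1 (nat_of_ord l, j0) (k, j)) by [].
apply: eq_bigr => l _; rewrite /lev /=; case: (boolP (nat_of_ord l \in S)) => hl /=.
  by rewrite big1 // mxE.
by rewrite mxE; apply: eq_bigr => q _; rewrite mxE.
Qed.

Lemma PbSS n l : Pb n.+1 l.+1 = Hb Am1 A0 A1 n.+1 l.+1.
Proof.
rewrite /Defs.Pb /Hb /=.
by do ![case: eqP => ?]; rewrite //; exfalso; lia.
Qed.

(** The taboo does not apply to the final state, so the last step is the descent [Am1] from level 1,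
    preceded by [t] steps of the killed chain. *)
Lemma blk_Ts_to0 t n :
  blk (Ts [:: 0%N] t.+1) n.+1 0 = Hpow Am1 A0 A1 t n.+1 1 *m Am1.
Proof.
elim: t n => [|t IH] n.
  by rewrite blk_Ts1 /Defs.Pb /= !eqSS eq_sym; case: eqP; rewrite ?mul1mx ?mul0mx.
rewrite blk_TsS big_mkcond big_ltn //= add0r mulmx_suml.
apply: eq_big_nat => -[//|l] _; rewrite inE /=.
by rewrite IH PbSS mulmxA.
Qed.

Lemma blk_Ts_taboo0 t n :
  blk (Ts [:: 0%N] t.+1) n.+1 1 = Hpow Am1 A0 A1 t.+1 n.+1 1.
Proof.
elim: t n => [|t IH] n.
  rewrite blk_Ts1 PbSS (@Hpow_recr _ _ _ _ _ 0 n.+1 1 n.+3) //=.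
  rewrite (bigD1_seq n.+1) ?iota_uniq ?mem_index_iota //= ?eqxx ?mul1mx ?ltnS //.
  rewrite big1 ?addr0 // => l /negPf; rewrite eq_sym => ->.
  by rewrite mul0mx.
rewrite blk_TsS big_mkcond big_ltn //= add0r.
apply: eq_big_nat => -[//|l] _; rewrite inE /=.
by rewrite IH PbSS.
Qed.

Lemma blk_Ts_01 t :
  blk (Ts [:: 0%N] t.+1) 0 1 = A1 *m Hpow Am1 A0 A1 t 1 1.
Proof.
case: t => [|t]; first by rewrite blk_Ts1 /= mulmx1.
rewrite blk_TsS big_mkcond big_ltn //= add0r big_nat1 /=.
by rewrite blk_Ts_taboo0.
Qed.

(** Level homogeneity: with levels 0 and 1 forbidden, the chain above level 1 is the chain above
    level 0 shifted by one level. *)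
Lemma blk_Ts_21 t n :
  blk (Ts [:: 0%N; 1%N] t.+1) n.+2 1 = Hpow Am1 A0 A1 t n.+1 1 *m Am1.
Proof.
elim: t n => [|t IH] n.
  rewrite blk_Ts1 PbSS /Hb /= !eqSS /= eq_sym; case: n => [|n] /=.
    by rewrite mul1mx.
  by rewrite mul0mx.
rewrite blk_TsS big_mkcond big_ltn //= add0r big_ltn //= add0r big_add1 /= mulmx_suml.
apply: eq_big_nat => -[//|l] _; rewrite !inE /=.
by rewrite IH PbSS mulmxA; congr (_ *m _ *m _).
Qed.

Lemma blk_Ts_11 t :
  blk (Ts [:: 0%N; 1%N] t.+2) 1 1 = A1 *m Hpow Am1 A0 A1 t 1 1 *m Am1.
Proof.
rewrite blk_TsS big_mkcond big_ltn //= add0r big_ltn //= add0r big_nat1 /=.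
by rewrite blk_Ts_21 mulmxA.
Qed.

Variables (Rm Gm Um N : 'M[R]_m).
Hypothesis N_sums : msums (fun nu => Hpow Am1 A0 A1 nu 1 1) N.

Lemma Rm_eq : msums (fun t => blk (Ts [:: 0%N] t.+1) 0 1) Rm -> Rm = A1 *m N.
Proof.
move/msumsP => h; apply: mlim_uniq h _.
apply: mlim_ext (mlimMl A1 ((msumsP _ _).1 N_sums)) _ => K.
by rewrite mulmx_sumr; apply: eq_bigr => t _; rewrite blk_Ts_01.
Qed.

Lemma Gm_eq : msums (fun t => blk (Ts [:: 0%N] t.+1) 1 0) Gm -> Gm = N *m Am1.
Proof.
move/msumsP => h; apply: mlim_uniq h _.
apply: mlim_ext (mlimMr Am1 ((msumsP _ _).1 N_sums)) _ => K.
by rewrite mulmx_suml; apply: eq_bigr => t _; rewrite blk_Ts_to0.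
Qed.

Lemma Um_eq : msums (fun t => blk (Ts [:: 0%N; 1%N] t.+1) 1 1) Um ->
  Um = A0 + A1 *m (N *m Am1).
Proof.
move/msumsP => h; apply: mlim_uniq ((mlim_shift 1 _ _).2 h) _; rewrite mulmxA.
apply: mlim_ext (mlimD (mlim_cst A0) (mlimMr Am1 (mlimMl A1 ((msumsP _ _).1 N_sums)))) _ => K.
(* A return to level 1 in one step is the term [A0]; every longer one is an excursion above level 1,
   started by [A1] and ended by [Am1]. *)
rewrite addn1 big_ord_recl blk_Ts1; congr (_ + _).
by rewrite mulmx_sumr mulmx_suml; apply: eq_bigr => t _; rewrite lift0 blk_Ts_11.
Qed.

End TabooProbabilities.

(** * The transition operator and invariant measures *)

Section Operator.
Variables (R : realType) (m : nat) (B Am1 A0 A1 : 'M[R]_m).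
Local Notation state := (state m).
Local Notation Pb := (Pb B Am1 A0 A1).
Local Notation Ps := (Ps B Am1 A0 A1).
Local Notation Pn := (Pn B Am1 A0 A1).
Implicit Types (f g : state -> R) (x y : state).

Definition Pop f x : R :=
  \sum_(l < x.1.+2) \sum_(j : 'I_m) Ps x (nat_of_ord l, j) * f (nat_of_ord l, j).

Definition Piter t f : state -> R := iter t Pop f.

Definition delta y x : R := (x == y)%:R.

Lemma Pn_Piter t x y : Pn t x y = Piter t (delta y) x.
Proof.
elim: t x => //= t IH x.
by apply: eq_bigr => l _; apply: eq_bigr => j _; rewrite IH.
Qed.

Definition fcol f l : 'cV[R]_m := \col_j f (l, j).

(** The transition operator in block form, acting on columns of any width, so that it applies both
    to functions and to whole block columns of [K]. *)
Definition Pcol p (h : nat -> 'M[R]_(m, p)) n : 'M[R]_(m, p) :=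
  if n is n'.+1 then Am1 *m h n' + A0 *m h n + A1 *m h n.+1
  else B *m h 0%N + A1 *m h 1%N.

Lemma PcolD p (h1 h2 : nat -> 'M[R]_(m, p)) n :
  Pcol (fun l => h1 l + h2 l) n = Pcol h1 n + Pcol h2 n.
Proof.
case: n => [|n] /=; rewrite !mulmxDr; first by rewrite addrACA.
by rewrite [X in X + _ = _]addrACA [LHS]addrACA.
Qed.

Lemma PcolMr p q (h : nat -> 'M[R]_(m, p)) (X : 'M[R]_(p, q)) n :
  Pcol (fun l => h l *m X) n = Pcol h n *m X.
Proof. by case: n => [|n] /=; rewrite !mulmxA -!mulmxDl. Qed.

Lemma PcolN p (h : nat -> 'M[R]_(m, p)) n : Pcol (fun l => - h l) n = - Pcol h n.
Proof. by case: n => [|n] /=; rewrite !mulmxN -!opprD. Qed.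

Lemma sum_Pb p (X : nat -> 'M[R]_(m, p)) n : \sum_(l < n.+2) Pb n l *m X l = Pcol X n.
Proof.
case: n => [|n]; first by rewrite !big_ord_recr big_ord0 /= add0r.
rewrite !big_ord_recr /= big1 ?add0r => [|l _]; last first.
  by rewrite /Defs.Pb /=; do ![case: eqP => ?]; rewrite ?mul0mx //; have := ltn_ord l; lia.
have -> : Pb n.+1 n = Am1 by rewrite /Defs.Pb /= eqxx.
have -> : Pb n.+1 n.+1 = A0 by rewrite /Defs.Pb /=; case: eqP => [|_]; [lia|rewrite eqxx].
have -> : Pb n.+1 n.+2 = A1.
  by rewrite /Defs.Pb /=; do 2![case: eqP => [|_]; first lia]; rewrite eqxx.
by [].
Qed.

Lemma PopE f n i : Pop f (n, i) = Pcol (fcol f) n i 0.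
Proof.
rewrite -sum_Pb summxE; apply: eq_bigr => l _; rewrite mxE.
by apply: eq_bigr => j _; rewrite mxE.
Qed.

Lemma fcol_Pop f n : fcol (Pop f) n = Pcol (fcol f) n.
Proof. by apply/colP => i; rewrite mxE PopE. Qed.

Lemma Pop_lin (a : R) f g x : Pop (fun z => a * f z + g z) x = a * Pop f x + Pop g x.
Proof.
rewrite /Pop mulr_sumr -big_split /=; apply: eq_bigr => l _.
rewrite mulr_sumr -big_split /=; apply: eq_bigr => j _; ring.
Qed.

Lemma Piter_lin t (a : R) f g x :
  Piter t (fun z => a * f z + g z) x = a * Piter t f x + Piter t g x.
Proof.
elim: t x => //= t IH x; rewrite -Pop_lin; congr Pop; exact/funext.
Qed.

Lemma PiterD s t f x : Piter (s + t) f x = Piter s (Piter t f) x.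
Proof. by rewrite /Piter iterD. Qed.

Hypotheses (B_ge0 : 0 <=m B) (Am1_ge0 : 0 <=m Am1) (A0_ge0 : 0 <=m A0) (A1_ge0 : 0 <=m A1).

Lemma Ps_ge0 x y : 0 <= Ps x y.
Proof.
have h (M : 'M[R]_m) i j : 0 <=m M -> 0 <= M i j by move/(_ i j); rewrite mxE.
by rewrite /Defs.Ps; apply: h; rewrite /Defs.Pb; do ![case: ifP => _].
Qed.

Lemma Pop_le f g x : (forall z, f z <= g z) -> Pop f x <= Pop g x.
Proof.
move=> h; apply: ler_sum => l _; apply: ler_sum => j _; apply: ler_wpM2l => //.
exact: Ps_ge0.
Qed.

Lemma Piter_le t f g x : (forall z, f z <= g z) -> Piter t f x <= Piter t g x.
Proof. by move=> h; elim: t x => //= t IH x; apply: Pop_le. Qed.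

Hypotheses (stochB : (B + A1) *m ones R m = ones R m)
  (stochA : (Am1 + A0 + A1) *m ones R m = ones R m).

Lemma Pcol_ones n : Pcol (fun=> ones R m) n = ones R m.
Proof. by case: n => [|n] /=; rewrite -!mulmxDl. Qed.

Lemma fcol_cst (a : R) l : fcol (fun=> a) l = a *: ones R m.
Proof. by apply/colP => i; rewrite !mxE mulr1. Qed.

Lemma Pop_cst (a : R) x : Pop (fun=> a) x = a.
Proof.
case: x => n i; rewrite PopE.
have -> : Pcol (fcol (fun=> a)) n = a *: Pcol (fun=> ones R m) n.
  by case: n => [|n] /=; rewrite !fcol_cst -!scalemxAr -!scalerDr.
by rewrite Pcol_ones !mxE mulr1.
Qed.

Lemma Piter_cst t (a : R) x : Piter t (fun=> a) x = a.
Proof.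
elim: t x => //= t IH x; rewrite -[RHS](Pop_cst a x); congr Pop; exact/funext.
Qed.

Lemma Piter_norm t f g x : (forall z, `|f z| <= g z) -> `|Piter t f x| <= Piter t g x.
Proof.
move=> h; apply/ler_normlP; split; last first.
  by apply: Piter_le => z; apply: le_trans (ler_norm _) (h z).
have -> : - Piter t f x = Piter t (fun z => (-1) * f z + 0) x.
  by rewrite Piter_lin Piter_cst addr0 mulN1r.
by apply: Piter_le => z; rewrite addr0 mulN1r; apply: le_trans (ler_norm _) _; rewrite normrN.
Qed.

Lemma Piter_bounded t f (c : R) x : (forall z, `|f z| <= c) -> `|Piter t f x| <= c.
Proof. by move=> h; rewrite -(Piter_cst t c x); apply: Piter_norm. Qed.

(** Balance at level 0 is kept apart, because for the difference [pi n - pi 0 *m Rm ^+ n] it has to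
    be derived from the balance at the other levels. *)
Definition interior_balanced (rho : nat -> 'rV[R]_m) : Prop :=
  forall n, rho n.+1 = rho n *m A1 + rho n.+1 *m A0 + rho n.+2 *m Am1.

(** Summation by parts over the levels up to [N]. What remains is the defect of balance at level 0
    and the exchange across the boundary between levels [N] and [N+1]. *)
Lemma level_telescope (rho : nat -> 'rV[R]_m) (h : nat -> 'cV[R]_m) N :
  interior_balanced rho ->
  \sum_(l < N.+1) rho l *m Pcol h l = \sum_(l < N.+1) rho l *m h l
    + (rho 0%N *m B + rho 1%N *m Am1 - rho 0%N) *m h 0%N
    + (rho N *m A1 *m h N.+1 - rho N.+1 *m Am1 *m h N).
Proof.
move=> hrho; elim: N => [|N IH].
  rewrite !big_ord1 /= mulmxDr !mulmxBl !mulmxDl !mulmxA.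
  move: (_ *m h 0%N) (_ *m h 0%N) (_ *m h 0%N) (_ *m h 1%N) => a b c d.
  by apply/matrixP => i j; rewrite !mxE; ring.
rewrite big_ord_recr IH [in RHS]big_ord_recr /=.
have -> : rho N.+1 *m h N.+1 =
    rho N *m A1 *m h N.+1 + rho N.+1 *m A0 *m h N.+1 + rho N.+2 *m Am1 *m h N.+1.
  by rewrite -!mulmxDl -hrho.
rewrite !mulmxDr !mulmxA.
set s := \sum_(_ < _) _; move: s => s.
by apply/matrixP => i j; rewrite !mxE; ring.
Qed.

Section Balanced.
Variable rho : nat -> 'rV[R]_m.
Hypotheses (rho_ge0 : forall n, 0 <=m rho n) (rho_int : interior_balanced rho)
  (rho_bd : rho 0%N = rho 0%N *m B + rho 1%N *m Am1).

Definition psum N f : R := \sum_(l < N) \sum_j rho l 0 j * f (nat_of_ord l, j).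

Lemma psumE N f : psum N f = (\sum_(l < N) rho l *m fcol f l) 0 0.
Proof.
rewrite summxE; apply: eq_bigr => l _; rewrite mxE.
by apply: eq_bigr => j _; rewrite mxE.
Qed.

Lemma rho_ge0E n j : 0 <= rho n 0 j.
Proof. by have := rho_ge0 n 0 j; rewrite mxE. Qed.

Lemma psum_Pop N f : psum N.+1 (Pop f) = psum N.+1 f +
  ((rho N *m A1 *m fcol f N.+1) 0 0 - (rho N.+1 *m Am1 *m fcol f N) 0 0).
Proof.
rewrite !psumE.
under eq_bigr do rewrite fcol_Pop.
rewrite level_telescope // -rho_bd subrr mul0mx addr0 mxE; congr (_ + _).
by rewrite [LHS]mxE; congr (_ + _); rewrite [LHS]mxE.
Qed.

(** Truncated integrals are not invariant, but the mass exchanged across the boundary is at most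
    that of level [N+1]. Each application of [P] thus costs one additional level. *)
Lemma psum_Pop_le N f : (forall x, 0 <= f x) -> psum N.+1 (Pop f) <= psum N.+2 f.
Proof.
move=> f0; have fc0 l : 0 <=m fcol f l by move=> i j; rewrite !mxE.
rewrite psum_Pop [X in _ <= X]/psum big_ord_recr /= -/(psum N.+1 f) lerD2l.
have -> : \sum_j rho N.+1 0 j * f (N.+1, j) = (rho N.+1 *m fcol f N.+1) 0 0.
  by rewrite mxE; apply: eq_bigr => j _; rewrite mxE.
have h1 : rho N *m A1 *m fcol f N.+1 <=m rho N.+1 *m fcol f N.+1.
  apply: mleM2r => //; rewrite rho_int -addrA -[X in X <=m _]addr0; apply: mleD => //.
  by apply: addmx_ge0; apply: mulmx_ge0.
have h2 : 0 <=m rho N.+1 *m Am1 *m fcol f N by do 2!apply: mulmx_ge0 => //.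
by have := h1 0 0; have := h2 0 0; rewrite [(0 : 'M_1) 0 0]mxE; lra.
Qed.

Lemma psum_Piter_le t N f : (forall x, 0 <= f x) ->
  psum N.+1 (Piter t f) <= psum (N + t).+1 f.
Proof.
move=> f0; elim: t N => [|t IH] N; first by rewrite addn0.
rewrite addnS -addSn; apply: le_trans (IH N.+1); apply: psum_Pop_le => x.
by rewrite -(Piter_cst t 0 x); apply: Piter_le.
Qed.

Lemma psum_ge_term N f x : (x.1 < N)%N -> (forall x, 0 <= f x) ->
  rho x.1 0 x.2 * f x <= psum N f.
Proof.
move=> xN f0; rewrite /psum (bigD1 (Ordinal xN)) //= (bigD1 x.2) //= -surjective_pairing.
rewrite -addrA lerDl addr_ge0 ?sumr_ge0 // => l _.
  by apply: mulr_ge0 => //; apply: rho_ge0E.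
by apply: sumr_ge0 => j _; apply: mulr_ge0 => //; apply: rho_ge0E.
Qed.

Lemma psum_delta N y : psum N (delta y) <= rho y.1 0 y.2.
Proof.
have [yN|Ny] := ltnP y.1 N.
  rewrite /psum (bigD1 (Ordinal yN)) //= (bigD1 y.2) //= /delta -surjective_pairing eqxx mulr1.
  rewrite big1 ?addr0 => [|j jy]; last first.
    by case: eqP => [e|]; rewrite ?mulr0 //; case/eqP: jy; rewrite -e.
  rewrite big1 ?addr0 // => l ly; rewrite big1 // => j _.
  case: eqP => [e|]; rewrite ?mulr0 //; case/eqP: ly; apply: val_inj.
  by rewrite /= -e.
rewrite /psum big1 ?rho_ge0E // => l _; rewrite big1 // => j _.
rewrite /delta; case: eqP => [e|]; rewrite ?mulr0 //.
by have := ltn_ord l; rewrite ltnNge (leq_trans Ny) // -e.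
Qed.

(** Only truncated sums enter, so [rho] may have infinite total mass. *)
Lemma balanced_Pn t x y : rho x.1 0 x.2 * Pn t x y <= rho y.1 0 y.2.
Proof.
have d0 z : 0 <= delta y z by rewrite /delta ler0n.
apply: le_trans (psum_delta (x.1 + t).+1 y).
apply: le_trans (psum_Piter_le t x.1 d0); rewrite Pn_Piter.
apply: psum_ge_term => // z.
by rewrite -(Piter_cst t 0 z); apply: Piter_le.
Qed.

Hypothesis irr : irreducible_chain B Am1 A0 A1.

Lemma balanced_gt0 x y : 0 < rho x.1 0 x.2 -> 0 < rho y.1 0 y.2.
Proof.
move=> hx; have [t ht] := irr x y.
by apply: lt_le_trans (balanced_Pn t x y); apply: mulr_gt0.
Qed.

End Balanced.

End Operator.

(** * Positivity, geometric form and first moment of the stationary distribution *)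

Section Stationary.
Variables (R : realType) (m : nat) (B Am1 A0 A1 : 'M[R]_m).
Hypotheses (B_ge0 : 0 <=m B) (Am1_ge0 : 0 <=m Am1) (A0_ge0 : 0 <=m A0) (A1_ge0 : 0 <=m A1).
Hypotheses (stochB : (B + A1) *m ones R m = ones R m)
  (stochA : (Am1 + A0 + A1) *m ones R m = ones R m).
Hypothesis irr : irreducible_chain B Am1 A0 A1.
Variable pi : nat -> 'rV[R]_m.
Hypothesis pi_stat : stationary B Am1 A0 A1 pi.

Lemma pi_ge0 n : 0 <=m pi n.
Proof. by move=> i j; rewrite mxE ord1; have [h _] := pi_stat; apply: h. Qed.

Lemma pi_sum1 : sums (fun n => \sum_j pi n 0 j) 1.
Proof. by have [_ [h _]] := pi_stat. Qed.

Lemma pi_level_ge0 n : 0 <= \sum_j pi n 0 j.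
Proof. by apply: sumr_ge0 => j _; have := pi_ge0 n 0 j; rewrite mxE. Qed.

(** The series in [stationary] is eventually constant, since level [k] cannot be reached in one step
    from level [k+2] or above. *)
Lemma pi_block k : pi k = \sum_(l < k.+2) pi l *m Pb B Am1 A0 A1 l k.
Proof.
apply/rowP => j; have [_ [_ /(_ (k, j)) h]] := pi_stat.
apply: sums_uniq h _; apply: (lims_eventually (N0 := k.+2)) => N hN.
rewrite summxE.
rewrite -(big_mkord xpredT (fun l => \sum_i pi l 0 i * Ps B Am1 A0 A1 (l, i) (k, j))).
rewrite (big_cat_nat (n := k.+2)) //= [X in _ + X]big_nat_cond [X in _ + X]big1 ?addr0.
  rewrite big_mkord; apply: eq_bigr => l _; rewrite mxE.
  by apply: eq_bigr => i _.
move=> l /andP[/andP[h1 _] _]; rewrite big1 // => i _; rewrite /Ps /Pb /=.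
by do ![case: eqP => ?]; rewrite ?mxE ?mulr0 //; lia.
Qed.

Lemma pi_bd : pi 0%N = pi 0%N *m B + pi 1%N *m Am1.
Proof. by rewrite {1}pi_block !big_ord_recr big_ord0 /= add0r. Qed.

Lemma pi_int : interior_balanced Am1 A0 A1 pi.
Proof.
move=> n; rewrite {1}pi_block !big_ord_recr /= big1 ?add0r => [|l _]; last first.
  rewrite /Pb; have := ltn_ord l.
  by do ![case: eqP => ?]; rewrite ?mulmx0 //; lia.
congr (_ + _ + _); congr (_ *m _); rewrite /Pb.
- by do ![case: eqP => ?]; rewrite //; lia.
- by rewrite /=; do ![case: eqP => ?]; rewrite //; lia.
- by rewrite /= eqxx.
Qed.

Lemma pi_gt0 x : 0 < pi x.1 0 x.2.
Proof.
have [y hy] : exists y : state m, 0 < pi y.1 0 y.2.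
  apply: contrapT => h.
  have h0 n : \sum_j pi n 0 j = 0.
    apply: big1 => j _; apply/eqP; rewrite eq_le; apply/andP; split.
      by rewrite leNgt; apply/negP => hj; apply: h; exists (n, j).
    by have := pi_ge0 n 0 j; rewrite mxE.
  have : (1 : R) = 0.
    apply: (sums_uniq pi_sum1); apply: lims_ext (lims_cst 0) _ => N.
    by rewrite big1.
  by move/eqP; rewrite oner_eq0.
apply: (balanced_gt0 B_ge0 Am1_ge0 A0_ge0 A1_ge0 stochB stochA pi_ge0 pi_int pi_bd irr _ hy).
Qed.

(** Excludes [m = 0]; the phase obtained here is the index [i0] needed for group inverses. *)
Lemma state_inhabited : exists x : state m, True.
Proof.
apply: contrapT => h; have : (1 : R) = 0.
  apply: (sums_uniq pi_sum1); apply: lims_ext (lims_cst 0) _ => N.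
  by rewrite big1 // => l _; rewrite big1 // => j _; case: h; exists (0%N, j).
by move/eqP; rewrite oner_eq0.
Qed.

Variable W : nat -> nat -> 'M[R]_m.
Hypothesis W_sums : forall n k, (0 < n)%N -> (0 < k)%N ->
  msums (fun nu => Hpow Am1 A0 A1 nu n k) (W n k).

Let N := W 1 1.
Let Rm := A1 *m N.
Let U := A0 + A1 *m (N *m Am1).

Let W1_sums n (n0 : (0 < n)%N) := W_sums n0 (ltn0Sn 0).

Lemma N_ge0 : 0 <=m N.
Proof. exact: (W_ge0 Am1_ge0 A0_ge0 A1_ge0 W1_sums). Qed.

Lemma Rm_ge0 : 0 <=m Rm.
Proof. by apply: mulmx_ge0 => //; apply: N_ge0. Qed.

Lemma N_eqr : N = 1%:M + N *m U.
Proof.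
have [uU eN _] := W_first_column Am1_ge0 A0_ge0 A1_ge0 W1_sums.
have : N *m (1%:M - U) = 1%:M by rewrite /N -eN mulVmx.
by rewrite mulmxBr mulmx1 => /eqP; rewrite subr_eq => /eqP.
Qed.

Lemma N_eql : N = 1%:M + U *m N.
Proof.
have [uU eN _] := W_first_column Am1_ge0 A0_ge0 A1_ge0 W1_sums.
have : (1%:M - U) *m N = 1%:M by rewrite /N -eN mulmxV.
by rewrite mulmxBl mul1mx => /eqP; rewrite subr_eq => /eqP.
Qed.

Lemma Rm_quadratic : Rm = A1 + Rm *m A0 + Rm *m Rm *m Am1.
Proof. by rewrite {1}/Rm N_eqr mulmxDr mulmx1 mulmxDr mulmxDr !mulmxA addrA. Qed.

Lemma A1_W1 k : A1 *m W 1 k.+1 = Rm ^+ k.+1.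
Proof.
by rewrite (W_first_row Am1_ge0 A0_ge0 A1_ge0 W_sums) mulmxA exprS -mulmxE.
Qed.

(* [pi_0 R^k <= pi_k] by minimality.  The difference is balanced in the interior and carries no
   probability flux, so it is a nonnegative invariant measure vanishing on level 0. *)
Lemma pi_geometric k : pi k = pi 0%N *m Rm ^+ k.
Proof.
pose d n := pi n - pi 0%N *m Rm ^+ n.
have d0 : d 0%N = 0 by rewrite /d expr0 mulmx1 subrr.
have d_ge0 n : 0 <=m d n.
  case: n => [|n]; first by rewrite d0.
  move=> i j; rewrite /d [X in _ <= X]mxE [X in _ + X]mxE mxE subr_ge0.
  rewrite -A1_W1 mulmxA.
  exact: (W_row_minimal Am1_ge0 A0_ge0 A1_ge0 W_sums pi_ge0 pi_int).
have d_int : interior_balanced Am1 A0 A1 d.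
  move=> n; rewrite /d {1}pi_int !mulmxBl.
  have hR : pi 0%N *m Rm ^+ n.+1 = pi 0%N *m Rm ^+ n *m A1
      + pi 0%N *m Rm ^+ n.+1 *m A0 + pi 0%N *m Rm ^+ n.+2 *m Am1.
    rewrite !exprSr -!mulmxE -!mulmxA -!mulmxDr; congr (_ *m (_ *m _)).
    by rewrite {1}Rm_quadratic !mulmxA.
  by rewrite {1}hR opprD [LHS]addrACA opprD [X in X + _ = _]addrACA.
have d_le n : d n <=m pi n.
  move=> i j; rewrite /d mxE gerDl mxE oppr_le0.
  have h : 0 <=m pi 0%N *m Rm ^+ n.
    by apply: mulmx_ge0; [apply: pi_ge0|apply: expmx_ge0; apply: Rm_ge0].
  by have := h i j; rewrite mxE.
have d_lim : mlim d 0.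
  move=> i j; rewrite mxE; apply: (lims0_norm (v := fun n => \sum_j pi n 0 j)).
    move=> n; have h := d_ge0 n i j; rewrite mxE in h.
    rewrite ger0_norm //; apply: le_trans (d_le n i j) _; rewrite ord1.
    rewrite (bigD1 j) //= lerDl; apply: sumr_ge0 => q _.
    by have := pi_ge0 n 0 q; rewrite mxE.
  exact: sums_term0 pi_sum1.
(* [level_telescope] at the constant function 1 shows that the net downward flux of [d] is the same
   across all boundaries, and it vanishes at infinity because [d] does. By nonnegativity
   [d 1 *m Am1] is then zero, which is the missing balance at level 0. *)
have flux : (d 1%N *m Am1) *m ones R m = 0.
  have hN M : (d 1%N *m Am1) *m ones R m =
      d M.+1 *m Am1 *m ones R m - d M *m A1 *m ones R m.
    have := level_telescope B (fun=> ones R m) M d_int.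
    under eq_bigr do rewrite (Pcol_ones stochB stochA).
    rewrite d0 mul0mx add0r subr0 -addrA -{1}[\sum_(_ < _) _]addr0 => /addrI /esym /eqP.
    by rewrite addr_eq0 opprB => /eqP.
  have l1 := mlimMr (ones R m) (mlimMr Am1 ((mlim_shift 1 _ _).2 d_lim)).
  have l2 := mlimMl (-1)%:M (mlimMr (ones R m) (mlimMr A1 d_lim)).
  have := mlimD l1 l2; rewrite !mul0mx mulmx0 addr0 => l3.
  apply: mlim_uniq (mlim_cst _) _; apply: mlim_ext l3 _ => M.
  by rewrite (hN M) addn1 mul_scalar_mx scaleN1r.
have dAm1 : d 1%N *m Am1 = 0.
  have nn : 0 <=m d 1%N *m Am1 by apply: mulmx_ge0.
  apply/rowP => j; rewrite [RHS]mxE.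
  have := congr1 (fun M : 'M_1 => M 0 0) flux; rewrite mxE [RHS]mxE => /eqP.
  rewrite psumr_eq0 => [|i _]; last first.
    by rewrite [X in _ * X]mxE mulr1; have := nn 0 i; rewrite [X in X <= _]mxE.
  by move=> /allP /(_ j (mem_index_enum _)) /=; rewrite [X in _ * X]mxE mulr1 => /eqP.
have d_bd : d 0%N = d 0%N *m B + d 1%N *m Am1 by rewrite dAm1 d0 mul0mx addr0.
have dz : d k = 0.
  apply/rowP => j; rewrite [RHS]mxE.
  have [t ht] := irr (k, j) (0%N, j).
  have := balanced_Pn B_ge0 Am1_ge0 A0_ge0 A1_ge0 stochB stochA d_ge0 d_int d_bd t (k, j) (0%N, j).
  rewrite /= d0 [X in _ <= X]mxE pmulr_lle0 // => h; apply/le_anti; rewrite h /=.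
  by have := d_ge0 k 0 j; rewrite mxE.
by apply/eqP; rewrite -subr_eq0; apply/eqP.
Qed.

Lemma Rm_neumann : [/\ 1%:M - Rm \in unitmx,
  msums (fun k => Rm ^+ k) (invmx (1%:M - Rm)) & 0 <=m invmx (1%:M - Rm)].
Proof.
(* Since [pi_0(i) (R^k)_ij <= pi_k(j)], and the [pi_k(j)] sum to at most 1 over [k], the row [i] of
   the series is bounded by the inverse of [pi_0(i)]. *)
have hb K : \sum_(k < K) Rm ^+ k <=m \matrix_(i, j) (pi 0%N 0 i)^-1.
  move=> i j; rewrite summxE mxE -[X in _ <= X]mulr1.
  have p0 := pi_gt0 (0%N, i).
  rewrite -ler_pdivrMl ?invr_gt0 // invrK mulr_sumr.
  apply: le_trans (sums_ge_partial K pi_level_ge0 pi_sum1).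
  apply: ler_sum => k _; rewrite (pi_geometric k) (bigD1 j) //=.
  have nn a b : 0 <= pi 0%N 0 a * (Rm ^+ k) a b.
    apply: mulr_ge0; first exact/ltW/(pi_gt0 (0%N, a)).
    by have := expmx_ge0 k Rm_ge0 a b; rewrite mxE.
  apply: le_trans (_ : (pi 0%N *m Rm ^+ k) 0 j <= _).
    by rewrite mxE (bigD1 i) //= lerDl sumr_ge0.
  by rewrite lerDl sumr_ge0 // => q _; rewrite mxE sumr_ge0.
by have [h1 h2 h3 _] := neumann Rm_ge0 hb.
Qed.

Lemma pi0_tau0 : pi 0%N *m tau0 Rm = 1%:M.
Proof.
have [_ /msumsP h _] := Rm_neumann.
have h1 := mlimMr (ones R m) (mlimMl (pi 0%N) h).
apply/matrixP => i j; rewrite !ord1 [RHS]mxE /= /tau0 mulmxA.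
apply: lims_uniq (h1 0 0) _; apply: lims_ext pi_sum1 _ => K.
rewrite mulmx_sumr mulmx_suml summxE; apply: eq_bigr => l _.
by rewrite -pi_geometric mxE; apply: eq_bigr => q _; rewrite mxE mulr1.
Qed.

(** Multiplying the sum of [(k+1) R^k] by [1 - R] telescopes to a partial Neumann sum minus a
    nonnegative term, so the sum itself is at most the square of the inverse of [1 - R]. The result
    is the dominating series for functions of linear growth. *)
Lemma pi_first_moment : exists s, sums (fun l => l.+1%:R * \sum_j pi l 0 j) s.
Proof.
have [hu /msumsP hS S0] := Rm_neumann; set S := invmx _ in hS S0.
have hSK K : \sum_(k < K) Rm ^+ k <=m S.
  move=> i j; have h := (msumsP _ _).2 hS i j; rewrite summxE.
  apply: (sums_ge_partial (u := fun k => (Rm ^+ k) i j)) => // l.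
  by have := expmx_ge0 l Rm_ge0 i j; rewrite mxE.
have hT K : (\sum_(k < K) k.+1%:R *: Rm ^+ k) *m (1%:M - Rm) =
    \sum_(k < K) Rm ^+ k - K%:R *: Rm ^+ K.
  elim: K => [|K IH]; first by rewrite !big_ord0 mul0mx scale0r subrr.
  rewrite !big_ord_recr /= mulmxDl IH mulmxBr mulmx1 -scalemxAl.
  rewrite [Rm ^+ K.+1]exprSr -mulmxE.
  move: (Rm ^+ K *m Rm) (Rm ^+ K) (\sum_(_ < _) _) => P Q T.
  by apply/matrixP => a b; rewrite !mxE -natr1; ring.
have hTS K : \sum_(k < K) k.+1%:R *: Rm ^+ k <=m S *m S.
  have -> : \sum_(k < K) k.+1%:R *: Rm ^+ k =
      (\sum_(k < K) k.+1%:R *: Rm ^+ k) *m (1%:M - Rm) *m S.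
    by rewrite -mulmxA mulmxV // mulmx1.
  rewrite hT; apply: mleM2r => // i j; rewrite mxE; apply: le_trans (hSK K i j).
  rewrite gerDl !mxE oppr_le0 mulr_ge0 //.
  by have := expmx_ge0 K Rm_ge0 i j; rewrite mxE.
apply: (@sums_bounded _ _ ((pi 0%N *m (S *m S) *m ones R m) 0 0)) => [l|K].
  by apply: mulr_ge0 => //; apply: pi_level_ge0.
have h : pi 0%N *m (\sum_(k < K) k.+1%:R *: Rm ^+ k) *m ones R m
    <=m pi 0%N *m (S *m S) *m ones R m.
  by apply: mleM2r; [apply: ones_ge0|apply: mleM2l; [apply: pi_ge0|apply: hTS]].
apply: le_trans (h 0 0).
rewrite mulmx_sumr mulmx_suml summxE; apply: ler_sum => l _.
rewrite -scalemxAr -pi_geometric -scalemxAl mxE ler_wpM2l // mxE.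
by apply: ler_sum => q _; rewrite mxE mulr1.
Qed.

End Stationary.

(** * The ergodic theorem for functions of linear growth *)

Section Ergodic.
Variables (R : realType) (m : nat) (B Am1 A0 A1 : 'M[R]_m).
Hypotheses (B_ge0 : 0 <=m B) (Am1_ge0 : 0 <=m Am1) (A0_ge0 : 0 <=m A0) (A1_ge0 : 0 <=m A1).
Hypotheses (stochB : (B + A1) *m ones R m = ones R m)
  (stochA : (Am1 + A0 + A1) *m ones R m = ones R m).
Variable pi : nat -> 'rV[R]_m.
Hypotheses (pi_ge0 : forall n, 0 <=m pi n) (pi_int : interior_balanced Am1 A0 A1 pi)
  (pi_bd : pi 0%N = pi 0%N *m B + pi 1%N *m Am1)
  (pi_gt0 : forall x : state m, 0 < pi x.1 0 x.2)
  (pi_sum1 : sums (fun n => \sum_j pi n 0 j) 1).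
Variable moment : R.
Hypothesis pi_moment : sums (fun l => l.+1%:R * \sum_j pi l 0 j) moment.

Local Notation state := (state m).
Local Notation Pop := (Pop B Am1 A0 A1).
Local Notation Piter := (Piter B Am1 A0 A1).
Local Notation Pn := (Pn B Am1 A0 A1).
Implicit Types (f g h : state -> R) (x y z a : state).

Definition lin_growth f : Prop := exists c : R, forall x, `|f x| <= c * x.1.+1%:R.

(** A limit of integrals truncated by level; [ExP] shows that it exists for functions of linear
    growth. *)
Definition Ex f : R := lim ((fun N => psum pi N f) @ \oo).

Lemma lin_growthD (k : R) f g :
  lin_growth f -> lin_growth g -> lin_growth (fun x => k * f x + g x).
Proof.
move=> [c hf] [d hg]; exists (`|k| * c + d) => x; rewrite mulrDl.
apply: le_trans (ler_normD _ _) _; rewrite normrM -mulrA; apply: lerD => //.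
exact: ler_wpM2l.
Qed.

Lemma bounded_lin_growth f (c : R) : (forall x, `|f x| <= c) -> lin_growth f.
Proof.
move=> hf; exists c => x; apply: le_trans (hf x) _; rewrite ler_peMr ?ler1n //.
exact: le_trans (normr_ge0 _) (hf x).
Qed.

Lemma rowcol_bound (v w : 'rV[R]_m) (u : 'cV[R]_m) (c : R) :
  0 <=m v -> v <=m w -> (forall i, `|u i 0| <= c) -> `|(v *m u) 0 0| <= c * \sum_j w 0 j.
Proof.
move=> v0 vw hu; rewrite mxE mulr_sumr; apply: le_trans (ler_norm_sum _ _ _) _.
apply: ler_sum => j _; rewrite normrM mulrC; apply: ler_pM => //.
by have := v0 0 j; rewrite mxE => h; rewrite ger0_norm.
Qed.

Lemma level_bound f (c : R) l : (forall x, `|f x| <= c * x.1.+1%:R) ->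
  `|\sum_j pi l 0 j * f (l, j)| <= c * (l.+1%:R * \sum_j pi l 0 j).
Proof.
move=> hf; have -> : \sum_j pi l 0 j * f (l, j) = (pi l *m fcol f l) 0 0.
  by rewrite mxE; apply: eq_bigr => j _; rewrite mxE.
rewrite mulrA; apply: rowcol_bound => // i; rewrite mxE; exact: (hf (l, i)).
Qed.

Lemma ExP f : lin_growth f -> sums (fun l => \sum_j pi l 0 j * f (l, j)) (Ex f).
Proof.
move=> [c hc].
have [s hs] := sums_dominated (fun l => level_bound l hc) (sumsZ c pi_moment).
have -> // : Ex f = s.
by apply: cvg_lim hs; exact: norm_hausdorff.
Qed.

Lemma Ex_eq f s : lin_growth f -> sums (fun l => \sum_j pi l 0 j * f (l, j)) s -> Ex f = s.
Proof. by move=> /ExP h1 h2; apply: sums_uniq h1 h2. Qed.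

Lemma Ex_lin (k : R) f g : lin_growth f -> lin_growth g ->
  Ex (fun x => k * f x + g x) = k * Ex f + Ex g.
Proof.
move=> hf hg; apply: Ex_eq; first exact: lin_growthD.
apply: sums_ext (sumsD (sumsZ k (ExP hf)) (ExP hg)) _ => l.
rewrite mulr_sumr -big_split /=; apply: eq_bigr => j _; ring.
Qed.

Lemma lin_growth_cst (k : R) : lin_growth (fun=> k).
Proof. by apply: (@bounded_lin_growth _ `|k|). Qed.

Lemma Ex_cst (k : R) : Ex (fun=> k) = k.
Proof.
apply: Ex_eq; first exact: lin_growth_cst.
rewrite -[X in sums _ X]mulr1; apply: sums_ext (sumsZ k pi_sum1) _ => l.
by rewrite mulr_sumr; apply: eq_bigr => j _; rewrite mulrC.
Qed.

Lemma Ex_le f g : lin_growth f -> lin_growth g -> (forall x, f x <= g x) -> Ex f <= Ex g.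
Proof.
move=> hf hg h; apply: sums_le (ExP hf) (ExP hg) _ => l.
by apply: ler_sum => j _; apply: ler_wpM2l => //; exact/ltW/(pi_gt0 (l, j)).
Qed.

Lemma Ex_ge_term f x : lin_growth f -> (forall z, 0 <= f z) -> pi x.1 0 x.2 * f x <= Ex f.
Proof.
move=> hf f0; apply: le_trans (sums_ge_partial x.1.+1 _ (ExP hf)).
  exact: psum_ge_term.
by move=> l; apply: sumr_ge0 => j _; apply: mulr_ge0 => //; exact/ltW/(pi_gt0 (l, j)).
Qed.

Lemma Ex_dominated (g : nat -> state -> R) (c : R) :
  (forall N x, `|g N x| <= c * x.1.+1%:R) -> (forall x, lims (g^~ x) 0) ->
  lims (fun N => Ex (g N)) 0.
Proof.
move=> hb h0; apply: (tannery (w := fun N l => \sum_j pi l 0 j * g N (l, j))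
  _ (sumsZ c pi_moment)) => [N l|l|N].
- exact: level_bound.
- have hj j : lims (fun N => pi l 0 j * g N (l, j)) 0.
    by rewrite -(mulr0 (pi l 0 j)); apply: limsZ; apply: h0.
  have := lims_sum (index_enum 'I_m) hj; rewrite big1 //.
- by apply: ExP; exists c.
Qed.

Lemma Pop_local f x (c : R) : (forall z, (z.1 <= x.1.+1)%N -> `|f z| <= c) -> `|Pop f x| <= c.
Proof.
move=> h; rewrite -(Pop_cst stochB stochA c x).
apply: le_trans (ler_norm_sum _ _ _) _; apply: ler_sum => l _.
apply: le_trans (ler_norm_sum _ _ _) _; apply: ler_sum => j _.
rewrite normrM ger0_norm ?Ps_ge0 //; apply: ler_wpM2l; first exact: Ps_ge0.
by apply: h => /=; rewrite -ltnS.
Qed.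

Lemma lin_growth_Pop f : lin_growth f -> lin_growth (Pop f).
Proof.
(* One step raises the level by at most one, and [n + 2 <= 2 (n + 1)]. *)
move=> [c hf]; exists (c * 2) => x; apply: Pop_local => z hz.
apply: le_trans (hf z) _; rewrite -mulrA; apply: ler_wpM2l.
  have := hf z; have : (0 : R) < z.1.+1%:R by rewrite ltr0n.
  by move=> z0 hz'; rewrite -(pmulr_lge0 _ z0); apply: le_trans hz'.
rewrite -natrM ler_nat; lia.
Qed.

Lemma lin_growth_Piter t f : lin_growth f -> lin_growth (Piter t f).
Proof. by move=> hf; elim: t => //= t; apply: lin_growth_Pop. Qed.

Lemma Ex_Pop f : lin_growth f -> Ex (Pop f) = Ex f.
Proof.
move=> hf; apply: Ex_eq; first exact: lin_growth_Pop.
apply: ((lims_shift 1 _ _).1); rewrite -[Ex f]addr0.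
have [c hc] := hf; have m0 := sums_term0 (sumsZ c pi_moment).
(* Both boundary terms of [psum_Pop] are dominated by terms of the convergent first-moment series,
   up to a shift of the index. *)
have b1 : lims (fun N => (pi N *m A1 *m fcol f N.+1) 0 0) 0.
  apply: lims0_norm ((lims_shift 1 _ _).2 m0) => N; rewrite addn1 mulrA.
  apply: rowcol_bound => [||i]; last by rewrite mxE; apply: (hc (N.+1, i)).
    exact: mulmx_ge0.
  rewrite (pi_int N) -addrA -[X in X <=m _]addr0; apply: mleD => //.
  by apply: addmx_ge0; apply: mulmx_ge0.
have b2 : lims (fun N => (pi N.+1 *m Am1 *m fcol f N) 0 0) 0.
  apply: lims0_norm m0 => N; rewrite mulrA.
  apply: rowcol_bound => [||i]; last by rewrite mxE; apply: (hc (N, i)).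
    exact: mulmx_ge0.
  case: N => [|N].
    rewrite [X in _ <=m X]pi_bd -[X in X <=m _]add0r; apply: mleD => //.
    exact: mulmx_ge0.
  rewrite [X in _ <=m X](pi_int N) -[X in X <=m _]add0r; apply: mleD => //.
  by apply: addmx_ge0; apply: mulmx_ge0.
have := limsB b1 b2; rewrite subrr => b3.
apply: lims_ext (limsD ((lims_shift 1 _ _).2 (ExP hf)) b3) _ => N.
by rewrite addn1 -/(psum pi N.+1 f) -(psum_Pop pi_int pi_bd).
Qed.

Lemma Ex_Piter t f : lin_growth f -> Ex (Piter t f) = Ex f.
Proof.
by move=> hf; elim: t => //= t IH; rewrite Ex_Pop //; apply: lin_growth_Piter.
Qed.

Lemma Piter_sub_sqr n g x (k : R) : Piter n (fun z => (g z - k) ^+ 2) x =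
  Piter n (fun z => g z ^+ 2) x - 2 * k * Piter n g x + k ^+ 2.
Proof.
have -> : (fun z => (g z - k) ^+ 2) =
    (fun z => (- (2 * k)) * g z + (1 * g z ^+ 2 + k ^+ 2)).
  by apply/funext => z; ring.
rewrite Piter_lin (Piter_lin _ _ _ _ _ _ (fun z => g z ^+ 2)) Piter_cst //; ring.
Qed.

Definition Pvar n g x : R := Piter n (fun z => g z ^+ 2) x - Piter n g x ^+ 2.

Lemma PvarE n g x : Pvar n g x = Piter n (fun z => (g z - Piter n g x) ^+ 2) x.
Proof. by rewrite Piter_sub_sqr /Pvar; ring. Qed.

Lemma Pvar_ge0 n g x : 0 <= Pvar n g x.
Proof.
rewrite PvarE -(Piter_cst stochB stochA n 0 x); apply: Piter_le => // z.
exact: sqr_ge0.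
Qed.

Lemma Pvar_ge n g x a : Pn n x a * (g a - Piter n g x) ^+ 2 <= Pvar n g x.
Proof.
rewrite PvarE; set k := Piter n g x.
have -> : Pn n x a * (g a - k) ^+ 2 = Piter n (fun z => (g a - k) ^+ 2 * delta R a z + 0) x.
  by rewrite Piter_lin Piter_cst // addr0 mulrC Pn_Piter.
apply: Piter_le => // z; rewrite addr0 /delta; case: eqP => [->|_].
  by rewrite mulr1.
by rewrite mulr0 sqr_ge0.
Qed.

Section Bounded.
Variables (f : state -> R) (c : R).
Hypothesis f_bd : forall x, `|f x| <= c.

Let sq N x := Piter N f x ^+ 2.

Let sq_bd N x : `|sq N x| <= c ^+ 2.
Proof.
rewrite /sq normrX; apply: lerXn2r; rewrite ?nnegrE //; last exact: Piter_bounded.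
exact: le_trans (normr_ge0 _) (f_bd x).
Qed.

Let sq_lin N : lin_growth (sq N).
Proof. exact: bounded_lin_growth (sq_bd N). Qed.

Let Pvar_lin n N : lin_growth (Pvar n (Piter N f)).
Proof.
have -> : Pvar n (Piter N f) = (fun x => -1 * sq (n + N) x + Piter n (sq N) x).
  by apply/funext => x; rewrite /Pvar /sq PiterD; ring.
by apply: lin_growthD => //; apply: lin_growth_Piter.
Qed.

(** Invariance removes the outer [P^n] from the second moment, which turns the mean variance into an
    increment of the monotone sequence [Ex (sq N)]. *)
Let Ex_Pvar n N : Ex (Pvar n (Piter N f)) = Ex (sq N) - Ex (sq (n + N)).
Proof.
have -> : Pvar n (Piter N f) = (fun x => -1 * sq (n + N) x + Piter n (sq N) x).
  by apply/funext => x; rewrite /Pvar /sq PiterD; ring.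
rewrite Ex_lin ?Ex_Piter //; first ring.
exact: lin_growth_Piter.
Qed.

Let sq_cvg : exists l, lims (fun N => Ex (sq N)) l.
Proof.
apply: (@lims_nonincreasing _ _ 0) => N.
  rewrite -subr_ge0 -add1n -Ex_Pvar -(Ex_cst 0); apply: Ex_le => //.
    exact: lin_growth_cst.
  by move=> x; apply: Pvar_ge0.
rewrite -(Ex_cst 0); apply: Ex_le => //; first exact: lin_growth_cst.
by move=> x; apply: sqr_ge0.
Qed.

(* [E ((P^N f)^2)] decreases to a limit, so the [n]-step conditional variance of [P^N f] vanishes. *)
Lemma Piter_asymp_const n x a : 0 < Pn n x a ->
  lims (fun N => Piter N f a - Piter (n + N) f x) 0.
Proof.
move=> Pxa; apply: lims0_sqr; have [l hl] := sq_cvg.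
set k := pi x.1 0 x.2 * Pn n x a; have k0 : 0 < k by apply: mulr_gt0.
have h0 : lims (fun N => k^-1 * (Ex (sq N) - Ex (sq (n + N)))) 0.
  rewrite -(mulr0 k^-1) -(subrr l); apply: limsZ; apply: limsB => //.
  by apply: lims_ext ((lims_shift n _ _).2 hl) _ => N; rewrite addnC.
apply: lims0_norm h0 => N; rewrite ger0_norm ?sqr_ge0 //.
rewrite -(ler_pM2l k0) mulVKf ?gt_eqF // -Ex_Pvar.
apply: le_trans (Ex_ge_term x (Pvar_lin n N) _); last exact: Pvar_ge0.
rewrite /k -mulrA; apply: ler_wpM2l; first exact: ltW.
by rewrite PiterD; apply: Pvar_ge.
Qed.

Hypotheses (irr : irreducible_chain B Am1 A0 A1) (aper : aperiodic_chain B Am1 A0 A1).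

(* The lags along which [P^N f] is asymptotically constant at [a] form a subgroup that contains
   the return times to [a]. *)
Lemma Piter_lag a d : lims (fun N => Piter N f a - Piter (d + N) f a) 0.
Proof.
pose D d := lims (fun N => Piter N f a - Piter (d + N) f a) 0.
have D_add d1 d2 : D d1 -> D d2 -> D (d1 + d2)%N.
  move=> h1 h2; have := limsD h2 ((lims_shift d2 _ _).2 h1); rewrite addr0.
  by move=> h; apply: lims_ext h _ => N /=; rewrite [(N + d2)%N]addnC addnA; ring.
have D_sub d1 d2 : D (d1 + d2)%N -> D d2 -> D d1.
  move=> h1 h2; have := limsB h1 h2; rewrite subrr => h.
  apply: ((lims_shift d2 _ _).1); apply: lims_ext h _ => N /=.
  by rewrite [(N + d2)%N]addnC addnA; ring.
have D0 : D 0%N by apply: lims_ext (lims_cst 0) _ => N; rewrite subrr.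
have D_mul q e : D e -> D (q * e)%N.
  by move=> he; elim: q => [|q IH]; rewrite ?mul0n // mulSn; apply: D_add.
suff D1 : D 1%N by rewrite -[d]muln1; apply: D_mul.
have hret t : 0 < Pn t a a -> D t by exact: Piter_asymp_const.
(* Without a positive lag there would be no return time, and aperiodicity applied to the vacuous
   period 2 would give [2 = 1]. *)
have exD : exists e, (0 < e)%N && `[< D e >].
  apply: contrapT => h; suff : 2%N = 1%N by [].
  apply: (aper (x := a)) => t t0 /hret Dt; case: h; exists t.
  by rewrite t0; apply/asboolP.
have [e /andP[e0 /asboolP De] emin] := ex_minnP exD.
(* The remainder of a return time modulo the least positive lag [e] is again a lag, hence 0; so [e]
   divides all return times. *)
have e1 : e = 1%N.
  apply: (aper (x := a)) => t t0 /hret Dt.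
  have : D (t %% e)%N.
    by apply: (D_sub _ (t %/ e * e)%N); rewrite ?[(_ %% _ + _)%N]addnC -?divn_eq //; apply: D_mul.
  case: (posnP (t %% e)%N) => [h _|h hD]; first by rewrite /dvdn h.
  have := emin (t %% e)%N; rewrite h => /(_ (introT andP (conj isT (asboolT hD)))).
  by rewrite leqNgt ltn_mod e0.
by rewrite -e1.
Qed.

Lemma ergodic_bounded x : lims (fun N => Piter N f x) (Ex f).
Proof.
have hxy y : lims (fun N => Piter N f x - Piter N f y) 0.
  have [n hn] := irr x y.
  have := limsB (Piter_lag x n) (Piter_asymp_const hn); rewrite subrr => h.
  by apply: lims_ext h _ => N /=; ring.
have fN N : lin_growth (Piter N f).
  by apply: (@bounded_lin_growth _ c) => z; apply: Piter_bounded.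
(* The values at [x] and [y] merge for every fixed [y]; integrating over [y] replaces [P^N f(y)] by
   its mean, which is [Ex f] for all [N]. *)
have h0 : lims (fun N => Ex (fun y => -1 * Piter N f y + Piter N f x)) 0.
  apply: (@Ex_dominated _ (c + c)) => [N y|y]; last first.
    by apply: lims_ext (hxy y) _ => N; ring.
  have c0 : 0 <= c by apply: le_trans (normr_ge0 _) (f_bd x).
  apply: le_trans (_ : c + c <= _); last by rewrite ler_peMr ?ler1n // addr_ge0.
  by apply: le_trans (ler_normD _ _) _; rewrite mulN1r normrN lerD ?Piter_bounded.
have := limsD h0 (lims_cst (Ex f)); rewrite add0r => h.
apply: lims_ext h _ => N /=.
by rewrite Ex_lin ?Ex_Piter ?Ex_cst //; [ring|exact: bounded_lin_growth f_bd|exact: lin_growth_cst].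
Qed.

End Bounded.

Hypotheses (irr : irreducible_chain B Am1 A0 A1) (aper : aperiodic_chain B Am1 A0 A1).

Theorem ergodic h x : lin_growth h -> lims (fun N => Piter N h x) (Ex h).
Proof.
move=> hh; have [c hc] := hh.
pose h1 L z := if (z.1 < L)%N then h z else 0.
pose h2 L z := if (z.1 < L)%N then 0 else `|h z|.
have h2c L z : `|h2 L z| <= c * z.1.+1%:R.
  rewrite /h2; case: ifP => _; rewrite ?normr_id // normr0.
  exact: le_trans (normr_ge0 _) (hc z).
have h2lin L : lin_growth (h2 L) by exists c.
have h2ge0 L z : 0 <= h2 L z by rewrite /h2; case: ifP.
have h1lin L : lin_growth (h1 L).
  exists c => z; rewrite /h1; case: ifP => // _; rewrite normr0.
  exact: le_trans (normr_ge0 _) (hc z).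
have c0 : 0 <= c.
  have := hc x; have : (0 : R) < x.1.+1%:R by rewrite ltr0n.
  by move=> z0 hz'; rewrite -(pmulr_lge0 _ z0); apply: le_trans hz'.
have h1bd L z : `|h1 L z| <= c * L%:R.
  rewrite /h1; case: ifP => [zL|_]; last by rewrite normr0 mulr_ge0.
  by apply: le_trans (hc z) _; apply: ler_wpM2l => //; rewrite ler_nat.
have h2E : lims (fun L => Ex (h2 L)) 0.
  apply: (@Ex_dominated _ c) => // z; apply: (lims_eventually (N0 := z.1.+1)) => L hL.
  by rewrite /h2 hL.
have hr L z : `|h z - h1 L z| <= h2 L z.
  by rewrite /h1 /h2; case: ifP => _; rewrite ?subrr ?normr0 // subr0.
have rlin L : lin_growth (fun z => h z - h1 L z).
  by exists c => z; apply: le_trans (hr L z) (le_trans (ler_norm _) (h2c L z)).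
set p := pi x.1 0 x.2; have p0 : 0 < p := pi_gt0 x.
(* This bound on the tail is uniform in [N]. In the factor [p^-1 + 1] chosen below, [p^-1] pays for
   the tail under [P^N] and 1 for the tail under [Ex]. *)
have h2P L N : Piter N (h2 L) x <= p^-1 * Ex (h2 L).
  rewrite -(ler_pM2l p0) mulVKf ?gt_eqF // -(Ex_Piter N (h2lin L)).
  apply: Ex_ge_term; first exact: lin_growth_Piter.
  by move=> z; rewrite -(Piter_cst stochB stochA N 0 z); apply: Piter_le.
apply/limsP => e e0.
have h3 : lims (fun L => (p^-1 + 1) * Ex (h2 L)) 0.
  by rewrite -(mulr0 (p^-1 + 1)); apply: limsZ.
have e20 : 0 < e / 2 by lra.
have [L hL] := (limsP _ _).1 h3 _ e20.
have {}hL := hL L (leqnn L).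
have [N0 hN] := (limsP _ _).1 (ergodic_bounded (h1bd L) irr aper x) _ e20.
exists N0 => N le; have {}hN := hN N le.
have hsplit : h = (fun z => 1 * h1 L z + (h z - h1 L z)) by apply/funext => z; ring.
rewrite hsplit Piter_lin Ex_lin //.
have r1 : `|Piter N (fun z => h z - h1 L z) x| <= p^-1 * Ex (h2 L).
  by apply: le_trans (h2P L N); apply: Piter_norm.
have r2 : `|Ex (fun z => h z - h1 L z)| <= Ex (h2 L).
  apply: sums_le_norm _ (ExP (h2lin L)) (ExP (rlin L)) => l.
  apply: le_trans (ler_norm_sum _ _ _) _; apply: ler_sum => j _.
  have pj := ltW (pi_gt0 (l, j)).
  by rewrite normrM ger0_norm //; apply: ler_wpM2l.
move: hN hL r1 r2; rewrite subr0 mulrDl mul1r.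
set u := Piter N (h1 L) x; set v := Piter N _ x; set u' := Ex (h1 L); set v' := Ex (fun _ => _).
set w := Ex (h2 L); set q := p^-1 * w; clearbody u v u' v' w q.
move=> /ltr_normlP [a1 a2] /ltr_normlP [b1 b2] /ler_normlP [c1 c2] /ler_normlP [d1 d2].
by apply/ltr_normlP; split; lra.
Qed.

Lemma harmonic_const h x : lin_growth h -> (forall z, Pop h z = h z) -> h x = Ex h.
Proof.
move=> hh hP; apply: lims_uniq (ergodic x hh).
apply: lims_ext (lims_cst (h x)) _ => N.
by elim: N x => //= N IH x; rewrite -[LHS]hP; congr Pop; apply/funext.
Qed.

(** The nonnegative function [h - P h] has integral 0 and [pi] is positive everywhere, so [h] is
    harmonic. *)
Lemma superharmonic_const h x y : lin_growth h -> (forall z, Pop h z <= h z) -> h x = h y.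
Proof.
move=> hh hP; suff hE z : Pop h z = h z by rewrite !(harmonic_const _ hh).
have dlin : lin_growth (fun z => -1 * Pop h z + h z).
  by apply: lin_growthD => //; apply: lin_growth_Pop.
have := Ex_ge_term z dlin; rewrite Ex_lin ?Ex_Pop //; last exact: lin_growth_Pop.
have -> : -1 * Ex h + Ex h = 0 by ring.
move=> /(_ _) H.
have {}H : pi z.1 0 z.2 * (-1 * Pop h z + h z) <= 0.
  by apply: H => w; have := hP w; lra.
rewrite (pmulr_rle0 _ (pi_gt0 z)) in H; have hz := hP z.
by apply/eqP; rewrite eq_le hz /=; lra.
Qed.

End Ergodic.

(** * Group inverses for stochastic matrices *)

Section StochasticMatrix.
Variables (R : realType) (m : nat) (S : 'M[R]_m).
Hypotheses (S_ge0 : 0 <=m S) (S_ones : S *m ones R m = ones R m).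

Lemma stoch_row_sum i : \sum_j S i j = 1.
Proof.
have := congr1 (fun M : 'cV_m => M i 0) S_ones; rewrite !mxE => <-.
by apply: eq_bigr => j _; rewrite mxE mulr1.
Qed.

Lemma stoch_expr_ones k : S ^+ k *m ones R m = ones R m.
Proof.
elim: k => [|k IH]; first by rewrite expr0 mul1mx.
by rewrite exprSr -mulmxE -mulmxA S_ones.
Qed.

Lemma stoch_contraction (v : 'cV[R]_m) (c : R) :
  (forall i, `|v i 0| <= c) -> forall i, `|(S *m v) i 0| <= c.
Proof.
move=> hv i; rewrite mxE -[c]mul1r -(stoch_row_sum i) mulr_suml.
apply: le_trans (ler_norm_sum _ _ _) _; apply: ler_sum => j _.
have hS := S_ge0 i j; rewrite mxE in hS.
by rewrite normrM ger0_norm //; apply: ler_wpM2l.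
Qed.

Lemma stoch_expr_contraction k (v : 'cV[R]_m) (c : R) :
  (forall i, `|v i 0| <= c) -> forall i, `|(S ^+ k *m v) i 0| <= c.
Proof.
move=> hv; elim: k => [|k IH]; first by rewrite expr0 mul1mx.
by rewrite exprS -mulmxE -mulmxA; apply: stoch_contraction.
Qed.

End StochasticMatrix.

Lemma choice_orP T (d : T) (P : T -> Prop) : (exists x, P x) -> P (choice_or d P).
Proof. by rewrite /choice_or => h; case: pselect => // h'; case: cid. Qed.

Lemma unitmx_ker0 (F : fieldType) n (M : 'M[F]_n) :
  (forall v : 'cV_n, M *m v = 0 -> v = 0) -> M \in unitmx.
Proof.
move=> h; rewrite unitmxE unitfE; apply/negP; rewrite -det_tr => /det0P[v v0 hv].
case/eqP: v0; apply: trmx_inj; rewrite trmx0; apply: h.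
by rewrite -[M]trmxK -trmx_mul hv trmx0.
Qed.

Section GroupInverse.
Variables (R : realType) (m : nat) (S : 'M[R]_m) (i0 : 'I_m).
Hypotheses (S_ge0 : 0 <=m S) (S_ones : S *m ones R m = ones R m).
Hypothesis S_ker : forall v : 'cV[R]_m, S *m v = v -> forall i j, v i 0 = v j 0.

Let M := 1%:M - S.
Let g := inv_prob S.

Let M_ones : M *m ones R m = 0.
Proof. by rewrite mulmxBl mul1mx S_ones subrr. Qed.

Lemma row_mul_ones (w : 'rV[R]_m) : w *m ones R m = (\sum_j w 0 j)%:M.
Proof.
apply/matrixP => i j; rewrite !ord1 !mxE /= mulr1n.
by apply: eq_bigr => k _; rewrite mxE mulr1.
Qed.

Lemma ones_neq0 : ones R m != 0.
Proof. by apply/eqP => /matrixP /(_ i0 0) /eqP; rewrite !mxE oner_eq0. Qed.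

(** Since [1 - S] is singular there is a left fixed vector [v]. Its entrywise absolute value
    satisfies [|v| <= |v| S], and both sides have the same total mass, so they agree. *)
Lemma inv_prob_exists : exists w : 'rV[R]_m,
  w *m S = w /\ (forall j, 0 <= w 0 j) /\ \sum_j w 0 j = 1.
Proof.
have /det0P[v v0 hv] : \det M == 0.
  rewrite -det_tr; apply/det0P; exists (ones R m)^T.
    by rewrite -(inj_eq (@trmx_inj _ _ _)) trmxK trmx0 ones_neq0.
  by rewrite -trmx_mul M_ones trmx0.
have vS : v *m S = v.
  by move: hv; rewrite mulmxBr mulmx1 => /eqP; rewrite subr_eq0 => /eqP.
pose a : 'rV[R]_m := \row_j `|v 0 j|.
have a0 j : 0 <= a 0 j by rewrite mxE.
have aS j : a 0 j <= (a *m S) 0 j.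
  rewrite mxE -{1}vS !mxE; apply: le_trans (ler_norm_sum _ _ _) _.
  apply: ler_sum => k _; rewrite normrM mxE.
  by have hS := S_ge0 k j; rewrite mxE in hS; rewrite [`|S k j|]ger0_norm.
have tot : \sum_j ((a *m S) 0 j - a 0 j) = 0.
  rewrite sumrB; have := congr1 (fun M : 'M_1 => M 0 0) (congr1 (mulmx a) S_ones).
  by rewrite mulmxA !row_mul_ones !mxE !mulr1n => ->; rewrite subrr.
have aSE : a *m S = a.
  apply/rowP => j; move/eqP: tot; rewrite psumr_eq0 => [|k _]; last by rewrite subr_ge0.
  by move=> /allP /(_ j (mem_index_enum _)) /=; rewrite subr_eq0 => /eqP.
have s0 : 0 < \sum_j a 0 j.
  rewrite lt0r sumr_ge0 // andbT; apply/negP; rewrite psumr_eq0 // => /allP h.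
  case/eqP: v0; apply/rowP => j; have := h j (mem_index_enum _).
  by rewrite /= !mxE normr_eq0 => /eqP.
exists ((\sum_j a 0 j)^-1 *: a); split; first by rewrite -scalemxAl aSE.
split; first by move=> j; rewrite mxE mulr_ge0 // invr_ge0 ltW.
under eq_bigr do rewrite mxE.
by rewrite -mulr_sumr mulVf // gt_eqF.
Qed.

Lemma inv_probP : g *m S = g /\ g *m ones R m = 1%:M.
Proof.
have [h1 [_ h2]] := choice_orP 0 inv_prob_exists.
by split=> //; rewrite row_mul_ones h2.
Qed.

Lemma ginvP : is_group_inverse M (ginv M).
Proof.
apply: choice_orP; have [gS g1] := inv_probP.
have gM : g *m M = 0 by rewrite mulmxBr mulmx1 gS subrr.
(* The inverse [Z] of [Q] is the fundamental matrix of the finite chain, and [Z - 1 g] is the group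
   inverse of [M]. *)
pose Q := M + ones R m *m g.
have Qu : Q \in unitmx.
  apply: unitmx_ker0 => v hv.
  have gv : g *m v = 0.
    have := congr1 (mulmx g) hv.
    by rewrite mulmx0 mulmxDl mulmxDr !mulmxA gM mul0mx add0r g1 mul1mx.
  have Sv : S *m v = v.
    move: hv; rewrite mulmxDl -mulmxA gv mulmx0 addr0 mulmxBl mul1mx.
    by move/eqP; rewrite subr_eq0 => /eqP.
  have hv' : v = ones R m *m (v i0 0)%:M.
    by apply/colP => i; rewrite mul_mx_scalar !mxE mulr1; apply: S_ker.
  move: gv; rewrite hv' mulmxA g1 mul1mx => ->; by rewrite mulmx0.
set Z := invmx Q.
have Z1 : Z *m ones R m = ones R m.
  have : Q *m ones R m = ones R m by rewrite mulmxDl M_ones add0r -mulmxA g1 mulmx1.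
  by move=> h; rewrite -{1}h mulmxA mulVmx // mul1mx.
have gZ : g *m Z = g.
  have : g *m Q = g by rewrite mulmxDr gM add0r mulmxA g1 mul1mx.
  by move=> h; rewrite -{1}h -mulmxA mulmxV // mulmx1.
have MZ : M *m Z = 1%:M - ones R m *m g.
  by rewrite -(mulmxV Qu) -/Z [Q *m Z]mulmxDl -[_ *m g *m Z]mulmxA gZ addrK.
have ZM : Z *m M = 1%:M - ones R m *m g.
  by rewrite -(mulVmx Qu) -/Z [Z *m Q]mulmxDr [Z *m (_ *m _)]mulmxA Z1 addrK.
exists (Z - ones R m *m g).
have MX : M *m (Z - ones R m *m g) = 1%:M - ones R m *m g.
  by rewrite mulmxBr MZ mulmxA M_ones mul0mx subr0.
have XM : (Z - ones R m *m g) *m M = 1%:M - ones R m *m g.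
  by rewrite mulmxBl ZM -mulmxA gM mulmx0 subr0.
split; last split; last by rewrite MX XM.
- by rewrite MX mulmxBl mul1mx -mulmxA gM mulmx0 subr0.
- rewrite XM mulmxBl mul1mx mulmxBr -mulmxA gZ -mulmxA [g *m (_ *m _)]mulmxA g1 mul1mx.
  by rewrite subrr subr0.
Qed.

(** [ginv] is a choice, so only its defining equations may be used. The columns of
    [E = 1 - M *m ginv M] are fixed by [S], hence constant, and [g E = g] identifies the
    constants. *)
Lemma mul_ginv : M *m ginv M = 1%:M - ones R m *m g.
Proof.
have [gS g1] := inv_probP; have [h1 [h2 h3]] := ginvP.
have gM : g *m M = 0 by rewrite mulmxBr mulmx1 gS subrr.
pose E := 1%:M - M *m ginv M.
have ME : M *m E = 0 by rewrite mulmxBr mulmx1 h3 mulmxA h1 subrr.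
have SE : S *m E = E.
  by move: ME; rewrite mulmxBl mul1mx => /eqP; rewrite subr_eq0 => /eqP.
have EE : E = ones R m *m row i0 E.
  apply/matrixP => i j; rewrite [RHS]mxE big_ord1 [X in X * _]mxE mul1r [RHS]mxE.
  have hc : S *m col j E = col j E.
    rewrite -[in RHS]SE; apply/colP => q; rewrite [RHS]mxE !mxE.
    by apply: eq_bigr => r _; rewrite [col _ _ _ _]mxE.
  by have := S_ker hc i i0; rewrite ![col _ _ _ _]mxE.
have gE : g *m E = g by rewrite mulmxBr mulmx1 mulmxA gM mul0mx subr0.
have : row i0 E = g by rewrite -gE [in RHS]EE mulmxA g1 mul1mx.
by move=> hr; rewrite -hr -EE /E opprB addrC subrK.
Qed.

Lemma inv_prob_unique (w : 'rV[R]_m) : w *m S = w -> w *m ones R m = 1%:M -> w = g.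
Proof.
move=> wS w1; have wM : w *m M = 0 by rewrite mulmxBr mulmx1 wS subrr.
have := congr1 (mulmx w) mul_ginv; rewrite mulmxA wM mul0mx mulmxBr mulmx1 mulmxA w1 mul1mx.
by move/eqP; rewrite eq_sym subr_eq0 => /eqP.
Qed.

End GroupInverse.

(** Maximum principle: where [v] is maximal, averaging by a power of [A] forces equality at every
    index that the power reaches. *)
Lemma irreducible_stoch_ker (R : realType) m (A : 'M[R]_m) (v : 'cV[R]_m) :
  0 <=m A -> A *m ones R m = ones R m -> (forall i j, exists t, 0 < (A ^+ t) i j) ->
  A *m v = v -> forall i j, v i 0 = v j 0.
Proof.
move=> A0 A1 irr Av i j.
have Atv t : A ^+ t *m v = v.
  elim: t => [|t IH]; first by rewrite expr0 mul1mx.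
  by rewrite exprSr -mulmxE -mulmxA Av.
have [k _ kmax] := arg_maxP (fun q => v q 0) (erefl : xpredT i).
suff hk q : v q 0 = v k 0 by rewrite !hk.
have [t ht] := irr k q.
have At0 : 0 <=m A ^+ t by apply: expmx_ge0.
have hrow := stoch_row_sum (stoch_expr_ones A1 t) k.
have : \sum_l (A ^+ t) k l * (v k 0 - v l 0) = 0.
  have := congr1 (fun w : 'cV_m => w k 0) (Atv t); rewrite mxE.
  under [in X in _ -> X]eq_bigr do rewrite mulrBr.
  by rewrite sumrB -mulr_suml hrow mul1r => ->; rewrite subrr.
move/eqP; rewrite psumr_eq0 => [|l _]; last first.
  apply: mulr_ge0; last by rewrite subr_ge0; apply: kmax.
  by have := At0 k l; rewrite mxE.
move=> /allP /(_ q (mem_index_enum _)) /=; rewrite mulf_eq0 gt_eqF //=.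
by rewrite subr_eq0 => /eqP.
Qed.

(** * The Poisson equation *)

Section Deviation.
Variables (R : realType) (m : nat) (B Am1 A0 A1 : 'M[R]_m).
Hypotheses (B_ge0 : 0 <=m B) (Am1_ge0 : 0 <=m Am1) (A0_ge0 : 0 <=m A0) (A1_ge0 : 0 <=m A1).
Hypotheses (stochB : (B + A1) *m ones R m = ones R m)
  (stochA : (Am1 + A0 + A1) *m ones R m = ones R m)
  (A_irr : forall i j, exists t, 0 < ((Am1 + A0 + A1) ^+ t) i j).
Hypotheses (irr : irreducible_chain B Am1 A0 A1) (aper : aperiodic_chain B Am1 A0 A1).
Variable pi : nat -> 'rV[R]_m.
Hypothesis pi_stat : stationary B Am1 A0 A1 pi.
Variable W : nat -> nat -> 'M[R]_m.
Hypothesis W_sums : forall n k, (0 < n)%N -> (0 < k)%N ->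
  msums (fun nu => Hpow Am1 A0 A1 nu n k) (W n k).

Local Notation state := (state m).
Local Notation Pop := (Pop B Am1 A0 A1).
Local Notation Pcol := (Pcol B Am1 A0 A1).
Local Notation Piter := (Piter B Am1 A0 A1).

Local Notation N := (W 1 1).
Variables (Rm Gm Um : 'M[R]_m).
Hypotheses (Rm_def : Rm = A1 *m N) (Gm_def : Gm = N *m Am1) (Um_def : Um = A0 + A1 *m (N *m Am1)).

Let W1_sums n (n0 : (0 < n)%N) := W_sums n0 (ltn0Sn 0).
Let pi_ge0 := pi_ge0 pi_stat.
Let pi_int := pi_int pi_stat.
Let pi_bd := pi_bd pi_stat.
Let pi_sum1 := pi_sum1 pi_stat.
Let pi_gt0 := pi_gt0 B_ge0 Am1_ge0 A0_ge0 A1_ge0 stochB stochA irr pi_stat.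
Let pi_geometric k : pi k = pi 0%N *m Rm ^+ k.
Proof.
rewrite Rm_def.
exact: (pi_geometric B_ge0 Am1_ge0 A0_ge0 A1_ge0 stochB stochA irr pi_stat W_sums).
Qed.
Let pi0_tau0 : pi 0%N *m tau0 Rm = 1%:M.
Proof.
rewrite Rm_def.
exact: (pi0_tau0 B_ge0 Am1_ge0 A0_ge0 A1_ge0 stochB stochA irr pi_stat W_sums).
Qed.
Let moment : exists s, sums (fun l => l.+1%:R * \sum_j pi l 0 j) s.
Proof.
exact: (pi_first_moment B_ge0 Am1_ge0 A0_ge0 A1_ge0 stochB stochA irr pi_stat W_sums).
Qed.
Let N_ge0 : 0 <=m N.
Proof. exact: (N_ge0 Am1_ge0 A0_ge0 A1_ge0 W_sums). Qed.
Let N_eql : N = 1%:M + Um *m N.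
Proof. rewrite Um_def; exact: (N_eql Am1_ge0 A0_ge0 A1_ge0 W_sums). Qed.

Let Gm_ge0 : 0 <=m Gm.
Proof. by rewrite Gm_def; apply: mulmx_ge0. Qed.

Lemma superharmonic_chain_const h x y : lin_growth h -> (forall z, Pop h z <= h z) -> h x = h y.
Proof.
have [s hs] := moment.
exact: (superharmonic_const B_ge0 Am1_ge0 A0_ge0 A1_ge0 stochB stochA pi_ge0 pi_int pi_bd
  pi_gt0 pi_sum1 hs irr aper).
Qed.

Let Um_Gm : Um = A0 + A1 *m Gm.
Proof. by rewrite Um_def -Gm_def. Qed.

Lemma Gm_quadratic : Gm = Am1 + A0 *m Gm + A1 *m Gm *m Gm.
Proof.
rewrite -addrA -mulmxDl -Um_Gm {2}Gm_def mulmxA -[X in X + _]mul1mx -mulmxDl -N_eql.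
exact: Gm_def.
Qed.

(** [G^n X] extends the boundary value [X] on level 0 to a function that is harmonic at all levels
    above it. *)
Lemma Pcol_Gm p (X : 'M[R]_(m, p)) n :
  Pcol (fun n => Gm ^+ n *m X) n.+1 = Gm ^+ n.+1 *m X.
Proof.
rewrite /= [Gm ^+ n.+2]exprS [Gm ^+ n.+1]exprS -!mulmxE -!mulmxA.
move: (Gm ^+ n *m X) => Y.
have hY : Gm *m Y = (Am1 + A0 *m Gm + A1 *m Gm *m Gm) *m Y by rewrite -Gm_quadratic.
by rewrite [RHS]hY !mulmxDl !mulmxA.
Qed.

Lemma Gm_ones_le : Gm *m ones R m <=m ones R m.
Proof.
rewrite Gm_def -mulmxA.
apply: (W_minimal Am1_ge0 A0_ge0 A1_ge0 W1_sums (Z := fun=> ones R m)) => // n n0.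
  exact: ones_ge0.
by have := sum_Hb Am1 A0 A1 (fun=> ones R m) n0; rewrite addrC => ->; rewrite -!mulmxDl stochA.
Qed.

Lemma Gm_ones : Gm *m ones R m = ones R m.
Proof.
have Gk0 k : 0 <=m Gm ^+ k *m ones R m.
  by apply: mulmx_ge0; [apply: expmx_ge0|apply: ones_ge0].
have Gk1 k : Gm ^+ k *m ones R m <=m ones R m.
  elim: k => [|k IH]; first by rewrite expr0 mul1mx.
  rewrite exprS -mulmxE -mulmxA; apply: mle_trans Gm_ones_le.
  exact: mleM2l.
pose h (x : state) := (Gm ^+ x.1 *m ones R m) x.2 0.
have hcol : fcol h = fun n => Gm ^+ n *m ones R m.
  by apply/funext => n; apply/colP => i; rewrite mxE.
have hlin : lin_growth h.
  apply: (@bounded_lin_growth _ _ _ 1) => x; rewrite ger0_norm.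
    by have := Gk1 x.1 x.2 0; rewrite [X in _ <= X]mxE.
  by have := Gk0 x.1 x.2 0; rewrite [X in X <= _]mxE.
(* Harmonic above level 0 by the quadratic equation of [G]; at level 0 the inequality is
   [G 1 <= 1]. *)
have hsup z : Pop h z <= h z.
  case: z => -[|n] i; rewrite PopE hcol; last by rewrite Pcol_Gm.
  rewrite /h /= expr0 expr1 mul1mx -[in X in _ <= X]stochB mulmxDl.
  have : B *m ones R m + A1 *m (Gm *m ones R m) <=m B *m ones R m + A1 *m ones R m.
    by apply: mleD => //; apply: mleM2l => //; apply: Gm_ones_le.
  by move/(_ i 0).
apply/colP => i; have := superharmonic_chain_const (1%N, i) (0%N, i) hlin hsup.
by rewrite /h /= expr0 expr1 mul1mx.
Qed.

(** On a fixed vector of [G] the quadratic equation reduces to [v = (Am1 + A0 + A1) v], and the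
    phase process is irreducible. *)
Lemma Gm_ker (v : 'cV[R]_m) : Gm *m v = v -> forall i j, v i 0 = v j 0.
Proof.
move=> Gv; apply: irreducible_stoch_ker stochA A_irr _.
  by do 2!apply: addmx_ge0 => //.
by rewrite -[RHS]Gv Gm_quadratic !mulmxDl -!mulmxA !Gv.
Qed.

Let Ps_ge0 : 0 <=m Pstar B A1 Gm.
Proof. by apply: addmx_ge0 => //; apply: mulmx_ge0. Qed.

Let Ps_ones : Pstar B A1 Gm *m ones R m = ones R m.
Proof. by rewrite mulmxDl -mulmxA Gm_ones -mulmxDl. Qed.

Lemma norm_le_sum (v : 'cV[R]_m) i : `|v i 0| <= \sum_j `|v j 0|.
Proof. by rewrite (bigD1 i) //= lerDl sumr_ge0. Qed.

Lemma Pstar_ker (v : 'cV[R]_m) : Pstar B A1 Gm *m v = v -> forall i j, v i 0 = v j 0.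
Proof.
move=> Pv i j; pose h (x : state) := (Gm ^+ x.1 *m v) x.2 0.
have hcol : fcol h = fun n => Gm ^+ n *m v.
  by apply/funext => n; apply/colP => q; rewrite mxE.
have hlin : lin_growth h.
  apply: (@bounded_lin_growth _ _ _ (\sum_j `|v j 0|)) => x.
  exact/(stoch_expr_contraction Gm_ge0 Gm_ones)/norm_le_sum.
have hharm z : Pop h z <= h z.
  case: z => -[|n] q; rewrite PopE hcol; last by rewrite Pcol_Gm.
  by rewrite /h /= expr0 expr1 mul1mx mulmxA -mulmxDl Pv.
have := superharmonic_chain_const (0%N, i) (0%N, j) hlin hharm.
by rewrite /h /= expr0 mul1mx.
Qed.

(** * Mean first passage times to level 0 *)

Let S := invmx (1%:M - Rm).

Let S_ge0 : 0 <=m S.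
Proof.
rewrite /S Rm_def.
by have [] := Rm_neumann B_ge0 Am1_ge0 A0_ge0 A1_ge0 stochB stochA irr pi_stat W_sums.
Qed.

Let S_eq : (1%:M - Rm) *m S = 1%:M.
Proof.
apply: mulmxV; rewrite Rm_def.
by have [] := Rm_neumann B_ge0 Am1_ge0 A0_ge0 A1_ge0 stochB stochA irr pi_stat W_sums.
Qed.

Let N_inv : invmx (1%:M - Um) = N /\ (1%:M - Um) *m N = 1%:M.
Proof.
have [uU eN _] := W_first_column Am1_ge0 A0_ge0 A1_ge0 W1_sums.
by rewrite Um_def eN; split=> //; rewrite -{2}eN mulmxV.
Qed.

Let i0_ex : exists i : 'I_m, True.
Proof. by have [[_ i] _] := state_inhabited pi_stat; exists i. Qed.

Local Notation t := (tau Rm Gm Um).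
Let u : 'cV[R]_m := N *m S *m ones R m.

(** [u] is the mean time to descend one level, and [G^l u] is its average after [l] levels have been
    descended. The closed form agrees with this sum because [(1 - G) (1 - G)^#] is the identity
    minus the projection [1 gamma]. *)
Lemma tau_sum n : t n = (\sum_(l < n) Gm ^+ l) *m u.
Proof.
have [i0 _] := i0_ex.
have hX := mul_ginv i0 Gm_ge0 Gm_ones Gm_ker.
rewrite /tau (proj1 N_inv) -/S -[_ *m N *m S *m _]mulmxA -[_ *m N *m _]mulmxA -/u.
rewrite [N *m _]mulmxA -/u; congr (_ *m _).
elim: n => [|n IH]; first by rewrite big_ord0 expr0 subrr mul0mx scale0r addr0.
rewrite big_ord_recr /= -IH.
have -> : 1%:M - Gm ^+ n.+1 = (1%:M - Gm ^+ n) + Gm ^+ n *m (1%:M - Gm).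
  by rewrite mulmxBr mulmx1 exprSr -mulmxE addrA subrK.
rewrite mulmxDl -mulmxA hX mulmxBr mulmx1 mulmxA (stoch_expr_ones Gm_ones).
rewrite -natr1 scalerDl scale1r; set a := _ *m ginv _; set b := ones R m *m _.
move: a b (Gm ^+ n) => a b c.
by apply/matrixP => p q; rewrite !mxE; ring.
Qed.

Let u_ge0 : 0 <=m u.
Proof. by apply: mulmx_ge0; [apply: mulmx_ge0|apply: ones_ge0]. Qed.

(** At level 0 the formula [tau] yields the hitting time 0 and not the return time [tau0]; this lets
    [K_split] cover all levels at once. *)
Lemma tau_0 : t 0 = 0.
Proof. by rewrite tau_sum big_ord0 mul0mx. Qed.

Lemma tau_S n : t n.+1 = t n + Gm ^+ n *m u.
Proof. by rewrite !tau_sum big_ord_recr mulmxDl. Qed.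

Lemma tau_ge0 n : 0 <=m t n.
Proof.
elim: n => [|n IH]; first by rewrite tau_0.
by rewrite tau_S; apply: addmx_ge0 => //; apply: mulmx_ge0 => //; apply: expmx_ge0.
Qed.

(** First-step analysis at level 0: a return takes one step, plus the descent from level 1 if that
    step went up. *)
Lemma A1_tau1 : A1 *m t 1 = tau0 Rm - ones R m.
Proof.
rewrite tau_S tau_0 add0r expr0 mul1mx /u !mulmxA -Rm_def /tau0 -/S.
have : S - Rm *m S = 1%:M by rewrite -S_eq mulmxBl mul1mx.
move/eqP; rewrite subr_eq => /eqP hS.
by rewrite [in RHS]hS mulmxDl mul1mx addrC addrA addNr add0r.
Qed.

(** Only the equation at level 1 needs computation: the increment [G^n u] of [tau] is harmonic above
    level 0, which carries the equation upwards. *)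
Lemma Pcol_tau n : Pcol t n.+1 = t n.+1 - ones R m.
Proof.
elim: n => [|n IH].
  rewrite /= tau_0 mulmx0 add0r [t 2]tau_S mulmxDr addrA.
  have -> : t 1 = u by rewrite tau_S tau_0 add0r expr0 mul1mx.
  have hu : u - Um *m u = tau0 Rm.
    by rewrite -[X in X - _]mul1mx -mulmxBl /u !mulmxA (proj2 N_inv) mul1mx.
  have hA : A1 *m u = tau0 Rm - ones R m.
    by rewrite -A1_tau1 tau_S tau_0 add0r expr0 mul1mx.
  have hU : A0 *m u + A1 *m (Gm *m u) = u - tau0 Rm.
    by rewrite mulmxA -mulmxDl -Um_Gm -hu opprB addrC subrK.
  rewrite expr1 addrAC hU hA.
  by rewrite addrA subrK.
have -> : Pcol t n.+2 = Pcol (fun l => t l + Gm ^+ l *m u) n.+1 by rewrite /= -!tau_S.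
rewrite PcolD IH Pcol_Gm [t n.+2]tau_S.
by rewrite addrAC.
Qed.

Lemma tau_bound : exists c : R, forall n i, `|t n i 0| <= c * n.+1%:R.
Proof.
exists (\sum_j `|u j 0|) => n i; set c := \sum_j _.
have c0 : 0 <= c by apply: sumr_ge0.
elim: n => [|n IH]; first by rewrite tau_0 mxE normr0 mulr1.
rewrite tau_S mxE -natr1 mulrDr mulr1; apply: le_trans (ler_normD _ _) (lerD IH _).
exact/(stoch_expr_contraction Gm_ge0 Gm_ones)/norm_le_sum.
Qed.

(** The visits to one state before level 0 cannot outnumber the steps. The matrix with all columns
    equal to [tau] is a supersolution, because the all-ones matrix produced by [Pcol_tau] dominates
    the identity. *)
Lemma W_le_tau n k i j : (0 < n)%N -> (0 < k)%N -> 0 <= W n k i j <= t n i 0.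
Proof.
move=> n0 k0; have Wk l (l0 : (0 < l)%N) := W_sums l0 k0; apply/andP; split.
  by have := W_ge0 Am1_ge0 A0_ge0 A1_ge0 Wk n0 i j; rewrite mxE.
pose J : 'rV[R]_m := const_mx 1.
have : W n k *m 1%:M <=m t n *m J.
  apply: (W_minimal Am1_ge0 A0_ge0 A1_ge0 Wk (Z := fun n => t n *m J)) => // l l0.
    by apply: mulmx_ge0; [apply: tau_ge0|move=> p q; rewrite !mxE].
  have := sum_Hb Am1 A0 A1 (fun n => t n *m J) l0.
  rewrite tau_0 mul0mx mulmx0 if_same addr0 => ->.
  case: l l0 => // l _; have := PcolMr B Am1 A0 A1 t J l.+1; rewrite Pcol_tau /= => ->.
  rewrite mulmxBl -{2}[t l.+1 *m J]add0r addrA addrAC.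
  apply: mleD => // p q; rewrite [X in X <= _]mxE [X in _ + X]mxE [X in _ <= X]mxE subr_le0.
  rewrite [X in _ <= X]mxE big_ord1 !mxE mulr1; case: ifP => _; rewrite mxE ?ler01 //.
  by case: (_ == _); rewrite ?ler01.
by move/(_ i j); rewrite mulmx1 [X in _ <= X]mxE big_ord1 [J _ _]mxE mulr1.
Qed.

(** * The Poisson equation for one block column of K *)

Section Column.
Variable k : nat.
Let K n := Kblk B A1 Rm Gm Um W pi n k.
Let K0 := ginv (1%:M - Pstar B A1 Gm) *m (1%:M - tau0 Rm *m pi 0%N) *m Rm ^+ k.
(** Extension of [W] by zero to level 0, where the chain is killed. *)
Let W0 n := if (n == 0%N) || (k == 0%N) then 0 else W n k.

Lemma K_split n : K n = W0 n - t n *m pi k + Gm ^+ n *m K0.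
Proof.
rewrite /K /Kblk /W0 -/K0; case: eqP => [->|_] /=.
  by rewrite tau_0 mul0mx expr0 mul1mx subr0 add0r.
by rewrite /K0; case: eqP => [->|_]; rewrite ?add0r.
Qed.

Lemma Pcol_W0 n : Pcol W0 n.+1 = W0 n.+1 - (if n.+1 == k then 1%:M else 0).
Proof.
case: (posnP k) => [k0|k0].
  by rewrite k0 /= /W0 k0 !orbT !mulmx0 !addr0 subr0.
have Wk l (l0 : (0 < l)%N) := W_sums l0 k0.
have kF : (k == 0%N) = false by rewrite gtn_eqF.
have e : W0 n.+1 = (if n.+1 == k then 1%:M else 0) + Pcol W0 n.+1.
  rewrite {1}/W0 kF /= (W_eq Wk) //; congr (_ + _).
  have := sum_Hb Am1 A0 A1 W0 (ltn0Sn n); rewrite {2}/W0 /= mulmx0 if_same addr0 => <-.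
  by apply: eq_big_nat => -[|l] //= _; rewrite /W0 kF.
by rewrite [in RHS]e addrC addKr.
Qed.

Lemma Pstar_K0 : Pstar B A1 Gm *m K0 = K0 - Rm ^+ k + tau0 Rm *m pi k.
Proof.
have [i0 _] := i0_ex.
pose M := 1%:M - Pstar B A1 Gm.
have hX : M *m ginv M = _ := mul_ginv i0 Ps_ge0 Ps_ones Pstar_ker.
pose s := \sum_j pi 0%N 0 j.
have s0 : 0 < s.
  rewrite /s (bigD1 i0) //=; apply: ltr_wpDr; last exact: (pi_gt0 (0%N, i0)).
  by apply: sumr_ge0 => j _; exact/ltW/(pi_gt0 (0%N, j)).
(* [P_*] is the chain watched on level 0: [pi_0 A1 G = pi_0 R Am1 = pi_1 Am1], so balance at level 0
   says that [pi_0] is invariant for it. *)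
have hg : s^-1 *: pi 0%N = inv_prob (Pstar B A1 Gm).
  apply: (inv_prob_unique i0 Ps_ge0 Ps_ones Pstar_ker).
    rewrite -scalemxAl; congr (_ *: _); rewrite mulmxDr [RHS]pi_bd; congr (_ + _).
    by rewrite (pi_geometric 1) expr1 Rm_def Gm_def !mulmxA.
  by rewrite -scalemxAl row_mul_ones -/s scale_scalar_mx mulVf // gt_eqF.
have hM : M *m K0 = Rm ^+ k - tau0 Rm *m pi k.
  rewrite /K0 !mulmxA hX -hg.
  (* The projection in [M *m ginv M] disappears because [pi_0 (1 - tau_0 pi_0) = 0], by
     [pi0_tau0]. *)
  have -> : (1%:M - ones R m *m (s^-1 *: pi 0%N)) *m (1%:M - tau0 Rm *m pi 0%N)
     = 1%:M - tau0 Rm *m pi 0%N.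
    rewrite mulmxBl mul1mx -[ones R m *m _ *m _]mulmxA -scalemxAl [pi 0%N *m _]mulmxBr mulmx1.
    rewrite [pi 0%N *m (_ *m _)]mulmxA pi0_tau0 mul1mx.
    by rewrite subrr scaler0 mulmx0 subr0.
  by rewrite mulmxBl mul1mx -[tau0 Rm *m _ *m _]mulmxA -pi_geometric.
have -> : Pstar B A1 Gm = 1%:M - M by rewrite /M opprB addrC subrK.
by rewrite mulmxBl mul1mx hM opprB addrA addrAC.
Qed.

Lemma Pcol_K n :
  Pcol K n = K n - (if n == k then 1%:M else 0) + ones R m *m pi k.
Proof.
have -> : K = fun n => W0 n - t n *m pi k + Gm ^+ n *m K0 by apply/funext => l; apply: K_split.
case: n => [|n].
  have hW : A1 *m W0 1 = Rm ^+ k - (if 0%N == k then 1%:M else 0).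
    rewrite /W0 /= ; case: k => [|l]; first by rewrite eqxx mulmx0 expr0 subrr.
    by rewrite /= subr0 (A1_W1 Am1_ge0 A0_ge0 A1_ge0 W_sums) Rm_def.
  rewrite /= expr0 expr1 mul1mx tau_0 mul0mx {1 2}/W0 /= subr0 add0r.
  rewrite mulmxDr mulmxBr [A1 *m (t 1 *m _)]mulmxA [A1 *m (Gm *m _)]mulmxA hW A1_tau1.
  rewrite addrC -addrA -mulmxDl [A1 *m Gm + B]addrC -/(Pstar B A1 Gm) Pstar_K0 mulmxBl.
  move: (Rm ^+ k) (tau0 Rm *m _) (ones R m *m _) (if _ then _ else _) => a b c d.
  by apply/matrixP => p q; rewrite !mxE; ring.
rewrite !PcolD PcolN Pcol_W0 (PcolMr B Am1 A0 A1 t (pi k)) Pcol_tau Pcol_Gm mulmxBl.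
move: (W0 n.+1) (t _ *m _) (ones R m *m _) (if _ then _ else _) (_ *m K0) => a b c d e.
by apply/matrixP => p q; rewrite !mxE; ring.
Qed.

Lemma K_lin_growth j : lin_growth (fun x : state => K x.1 x.2 j).
Proof.
have [c hc] := tau_bound.
have c0 : 0 <= c by have [i0 _] := i0_ex; have := hc 0%N i0; rewrite mulr1; apply: le_trans.
have hW0 : lin_growth (fun x : state => W0 x.1 x.2 j).
  exists c => x; rewrite /W0; case: ifP => [_|/negbT].
    by rewrite mxE normr0 mulr_ge0.
  rewrite negb_or -!lt0n => /andP[n0 k0].
  have /andP[h1 h2] := W_le_tau x.2 j n0 k0.
  by rewrite ger0_norm //; apply: le_trans h2 (le_trans (ler_norm _) (hc _ _)).
have ht : lin_growth (fun x : state => t x.1 x.2 0) by exists c => x; apply: hc.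
have hG : lin_growth (fun x : state => (Gm ^+ x.1 *m col j K0) x.2 0).
  apply: (@bounded_lin_growth _ _ _ (\sum_i `|col j K0 i 0|)) => x.
  exact/(stoch_expr_contraction Gm_ge0 Gm_ones)/norm_le_sum.
have := lin_growthD (- pi k 0 j) ht (lin_growthD 1 hW0 hG).
congr lin_growth; apply/funext => x; rewrite K_split.
rewrite [RHS]mxE [X in _ = X + _]mxE [X in _ = _ + X + _]mxE [(t _ *m pi k) _ _]mxE big_ord1.
have -> : (Gm ^+ x.1 *m K0) x.2 j = (Gm ^+ x.1 *m col j K0) x.2 0.
  by rewrite !mxE; apply: eq_bigr => q _; rewrite [col _ _ _ _]mxE.
ring.
Qed.

End Column.

Lemma deviation_sum : let K := Kblk B A1 Rm Gm Um W pi in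
  exists c : nat -> 'rV[R]_m,
    (forall k, msums (fun l => pi l *m K l k) (c k)) /\
    (forall (n k : nat) (i j : 'I_m),
       sums (fun t => Pn B Am1 A0 A1 t (n, i) (k, j) - pi k 0 j) (K n k i j - c k 0 j)).
Proof.
move=> K; have [s hs] := moment.
exists (fun k => \row_j Ex pi (fun x => K x.1 k x.2 j)); split=> [k i j|n k i j].
  rewrite !ord1 mxE; have := ExP pi_ge0 hs (K_lin_growth k j).
  by move/sums_ext; apply=> l; rewrite mxE.
rewrite mxE; pose h (x : state) := K x.1 k x.2 j.
have hlin : lin_growth h := K_lin_growth k j.
have hP z : Pop h z = h z - delta R (k, j) z + pi k 0 j.
  case: z => l q; rewrite PopE.
  have -> : Pcol (fcol h) l q 0 = Pcol (fun l => K l k) l q j.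
    have -> : fcol h = fun l => K l k *m delta_mx j (0 : 'I_1).
      by apply/funext => p; apply/colP => r; rewrite -colE !mxE.
    by rewrite PcolMr -colE mxE.
  rewrite Pcol_K !mxE big_ord1 mxE mul1r /h /delta /= xpair_eqE.
  by case: eqP => [->|_] /=; rewrite mxE.
have herg := ergodic B_ge0 Am1_ge0 A0_ge0 A1_ge0 stochB stochA pi_ge0 pi_int pi_bd
  pi_gt0 pi_sum1 hs irr aper (n, i) hlin.
apply: lims_ext (limsB (lims_cst (h (n, i))) herg) _ => M; elim: M => [|M IH].
  by rewrite big_ord0 subrr.
rewrite big_ord_recr /= -IH Pn_Piter.
have hPop : Pop h = fun z => -1 * delta R (k, j) z + (1 * h z + pi k 0 j).
  by apply/funext => z; rewrite hP; ring.
(* Moving the extra step inside, next to [h], is what allows the Poisson equation to be applied. *)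
have -> : Pop (Piter M h) (n, i) = Piter M (Pop h) (n, i).
  by rewrite -[LHS]/(Piter (1 + M) h _) addnC PiterD.
rewrite hPop Piter_lin Piter_lin Piter_cst //.
by ring.
Qed.

End Deviation.

Theorem theorem4p2 (R : realType) (m : nat) (B Am1 A0 A1 : 'M[R]_m)
  (pi : nat -> 'rV[R]_m) (Rm Gm Um : 'M[R]_m) (W : nat -> nat -> 'M[R]_m) :
  qbd_blocks B Am1 A0 A1 ->
  irreducible_chain B Am1 A0 A1 ->
  aperiodic_chain B Am1 A0 A1 ->
  pos_recurrent_chain B Am1 A0 A1 ->
  stationary B Am1 A0 A1 pi ->
  (* R_{ij} = E[# visits to (1,j) before returning to level 0 | X_0 = (0,i)] *)
  msums (fun t => blk (Ts B Am1 A0 A1 (lev [:: 0%N]) t.+1) 0 1) Rm ->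
  (* G_{ij} = P[level 0 is reached, first in (0,j) | X_0 = (1,i)] *)
  msums (fun t => blk (Ts B Am1 A0 A1 (lev [:: 0%N]) t.+1) 1 0) Gm ->
  (* U_{ij} = P[level 1 is revisited before level 0, at (1,j) | X_0 = (1,i)] *)
  msums (fun t => blk (Ts B Am1 A0 A1 (lev [:: 0%N; 1%N]) t.+1) 1 1) Um ->
  (* W = sum_nu H^nu, blockwise *)
  (forall n k, (0 < n)%N -> (0 < k)%N -> msums (fun nu => Hpow Am1 A0 A1 nu n k) (W n k)) ->
  let K := Kblk B A1 Rm Gm Um W pi in
  (* D = sum_t (P^t - 1 pi) converges entrywise to (I - 1 pi) K, where
     (1 pi K)_{(n,i),(k,j)} = (c_k)_j with c_k = sum_l pi_l K_{lk} *)
  exists c : nat -> 'rV[R]_m,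
    (forall k, msums (fun l => pi l *m K l k) (c k)) /\
    (forall (n k : nat) (i j : 'I_m),
       sums (fun t => Pn B Am1 A0 A1 t (n, i) (k, j) - pi k 0 j) (K n k i j - c k 0 j)).
Proof.
move=> [nn [hB [hA Airr]]] irr aper _ stat hR hG hU hW.
have W11 := hW 1%N 1%N isT isT.
have [B0 Am10 A00 A10] : [/\ 0 <=m B, 0 <=m Am1, 0 <=m A0 & 0 <=m A1].
  by split=> i j; rewrite mxE; have [? [? [? ?]]] := nn i j.
apply: (deviation_sum B0 Am10 A00 A10 hB hA Airr irr aper stat hW).
- exact: Rm_eq W11 hR.
- exact: Gm_eq W11 hG.
- exact: Um_eq W11 hU.
Qed.
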